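(* For every set $P\gg\emptyset'$ there exists a set $G$ bounding $\mathsf{EM}$ (i.e. every computable infinite tournament has a $G$-computable infinite transitive subtournament) such that $G'\leq_T P$.
   Context: $A\gg B$ means $A$ is of PA degree relative to $B$ (computes a member of every nonempty $\Pi^{0,B}_1$ class). A tournament $T$ on an infinite domain $D\subseteq\mathbb N$ is an irreflexive binary relation on $D$ with exactly one of $T(x,y)$, $T(y,x)$ for all distinct $x,y\in D$; a subset is transitive if $T$ restricted to it is transitive. $\mathsf{EM}$ (Erdős–Moser theorem): every infinite tournament has an infinite transitive subtournament. *)

(* Defs.v *)
From Stdlib Require Import Arith Cantor ClassicalDescription.

Definition pr (a b : nat) : nat := Cantor.to_nat (a, b).
Definition p1 (n : nat) : nat := fst (Cantor.of_nat n).
Definition p2 (n : nat) : nat := snd (Cantor.of_nat n).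

Definition set := nat -> bool.
Definition b2n (b : bool) : nat := if b then 1 else 0.

Inductive prog : Type :=
| PZero
| PSucc
| PId
| PFst
| PSnd
| POracle
| PComp (f g : prog)
| PPair (f g : prog)
| PRec (f g : prog)        (* h<a,0> = f a ; h<a,n+1> = g <a,<n,h<a,n>>> *)
| PMu (f : prog).          (* x |-> least i with f<x,i> = 0 (all earlier defined) *)

Fixpoint code (p : prog) : nat :=
  match p with
  | PZero => pr 0 0
  | PSucc => pr 1 0
  | PId => pr 2 0
  | PFst => pr 3 0
  | PSnd => pr 4 0
  | POracle => pr 5 0
  | PComp f g => pr 6 (pr (code f) (code g))
  | PPair f g => pr 7 (pr (code f) (code g))
  | PRec f g => pr 8 (pr (code f) (code g))
  | PMu f => pr 9 (code f)
  end.

Definition obind (o : option nat) (k : nat -> option nat) : option nat :=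
  match o with Some a => k a | None => None end.

Fixpoint eval (k : nat) (A : set) (p : prog) (x : nat) : option nat :=
  match k with
  | 0 => None
  | S k' =>
    match p with
    | PZero => Some 0
    | PSucc => Some (S x)
    | PId => Some x
    | PFst => Some (p1 x)
    | PSnd => Some (p2 x)
    | POracle => Some (b2n (A x))
    | PComp f g => obind (eval k' A g x) (eval k' A f)
    | PPair f g =>
        match eval k' A f x, eval k' A g x with
        | Some a, Some b => Some (pr a b)
        | _, _ => None
        end
    | PRec f g =>
        let a := p1 x in
        (fix r (n : nat) : option nat :=
           match n with
           | 0 => eval k' A f a
           | S n' => obind (r n') (fun h => eval k' A g (pr a (pr n' h)))
           end) (p2 x)
    | PMu f =>
        (fix s (i c : nat) : option nat :=
           match c with
           | 0 => None
           | S c' =>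
             match eval k' A f (pr x i) with
             | Some 0 => Some i
             | Some _ => s (S i) c'
             | None => None
             end
           end) 0 k'
    end
  end.

Definition conv (p : prog) (A : set) (x y : nat) : Prop :=
  exists k, eval k A p x = Some y.

Definition halts (p : prog) (A : set) (x : nat) : Prop :=
  exists y, conv p A x y.

Definition Treducible (B A : set) : Prop :=
  exists p, forall x, conv p A x (b2n (B x)).

Definition computable (B : set) : Prop := Treducible B (fun _ => false).

Definition jump (A : set) : set :=
  fun n => if excluded_middle_informative (exists p, code p = n /\ halts p A n)
           then true else false.

Definition emptyset : set := fun _ => false.

Definition join (B X : set) : set :=
  fun n => if Nat.even n then B (Nat.div2 n) else X (Nat.div2 n).

Definition in_Pi01 (B : set) (e : prog) (X : set) : Prop :=
  ~ halts e (join B X) 0.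

Definition PA_rel (A B : set) : Prop :=
  forall e : prog, (exists X, in_Pi01 B e X) ->
    exists X, in_Pi01 B e X /\ Treducible X A.

Definition infinite_set (D : set) : Prop :=
  forall n, exists m, n <= m /\ D m = true.

Definition tournament (D : set) (T : nat -> nat -> bool) : Prop :=
  infinite_set D /\
  (forall x y, T x y = true -> D x = true /\ D y = true) /\
  (forall x, T x x = false) /\
  (forall x y, D x = true -> D y = true -> x <> y ->
     (T x y = true /\ T y x = false) \/ (T x y = false /\ T y x = true)).

Definition transitive_sub (D : set) (T : nat -> nat -> bool) (H : set) : Prop :=
  (forall x, H x = true -> D x = true) /\
  (forall x y z, H x = true -> H y = true -> H z = true ->
     T x y = true -> T y z = true -> T x z = true).

Definition computable_tournament (D : set) (T : nat -> nat -> bool) : Prop :=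
  computable D /\ computable (fun n => T (p1 n) (p2 n)).

Definition bounds_EM (G : set) : Prop :=
  forall D T, tournament D T -> computable_tournament D T ->
    exists H, infinite_set H /\ transitive_sub D T H /\ Treducible H G.

(* Main.v *)
(* A tournament computed by a pair of programs can be pulled back along the map sending a stage to
   the latest element verified by then, so it suffices to treat a uniform sequence [R e] of total
   computable tournaments and to build one infinite [G] that, for every [e], has no 3-cycle of [R e]
   beyond some bound.

   [G] is built by Mathias forcing.  Given a finite part [F] and an infinite reservoir [X], ask for
   a stage [l] such that every colouring of [X] below [l] has a colour-homogeneous acyclic finite set
   [E] for which the computation in question halts with oracle [F ∪ E].  If there is one, apply this
   to the limit colouring [x |-> (R e x y)_e] for [y] in a thinned reservoir: homogeneity
   keeps the remaining reservoir compatible with [F ∪ E].  Otherwise compactness gives a colouring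
   without such [E], and passing to one of its infinite colour classes makes the computation diverge.

   All the colourings ever needed are the columns of one set [M] in a Pi^0_1 class, taken low by the
   low basis theorem.  Whether the guesses [W] of answers and of infinite parts of reservoirs are
   right is then a Pi^0_1 condition on [W] relative to the halting problem, so [P] computes such a
   [W], and the jump of [G] consists of the answers recorded in [W]. *)

From Stdlib Require Import Arith Cantor ClassicalEpsilon ClassicalDescription Lia Bool.
Require Import Defs.

(** * Oracle programs *)

(** The obstacle is that a colouring used after a negative answer cuts down the reservoir and so
    enters every later question; a separate low solution for each question would need lowness to be
    kept up along an infinite iteration. The remedy is that a state [s] is a number and every
    colouring mentioned by its reservoir has an index below [s]. Column [s] of [M] thus solves a
    problem that refers only to earlier columns. It has to be good only at levels where some
    colouring is good, so all these demands together define a nonempty class without any answer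
    being known in advance. The limit colouring is not computed as a limit either. At each time [x]
    the directions of [R e x y] for [e < x] are guessed and imposed on the reservoir, so that by
    time [t] the colouring is known below [t]; the search after a positive answer tests level [t] at
    time [t]. A tournament [R e] is respected only by questions asked after time [e]. This keeps the
    number of colours finite, and it is why each [e] has its own exceptional bound, which a
    reduction to [G] may contain as a constant. *)

Lemma p1_pr a b : p1 (pr a b) = a.
Proof. unfold p1, pr; now rewrite Cantor.cancel_of_to. Qed.

Lemma p2_pr a b : p2 (pr a b) = b.
Proof. unfold p2, pr; now rewrite Cantor.cancel_of_to. Qed.

Lemma pr_eta n : pr (p1 n) (p2 n) = n.
Proof. unfold pr, p1, p2; rewrite <- surjective_pairing; apply Cantor.cancel_to_of. Qed.

Lemma pr_ge a b : a + b <= pr a b.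
Proof. unfold pr; pose proof (Cantor.to_nat_non_decreasing a b); lia. Qed.

Lemma pr_le_square a b : pr a b <= (a + b) * (a + b) + a + b + b.
Proof. unfold pr; pose proof (Cantor.to_nat_spec a b); nia. Qed.

Lemma p1_le n : p1 n <= n.
Proof. rewrite <- (pr_eta n) at 2; pose proof (pr_ge (p1 n) (p2 n)); lia. Qed.

Lemma p2_le n : p2 n <= n.
Proof. rewrite <- (pr_eta n) at 2; pose proof (pr_ge (p1 n) (p2 n)); lia. Qed.

Global Opaque pr p1 p2.

(** Named copies of the anonymous fixpoints inside [eval], convertible to them, so that inductions
    on the loops can be stated separately. *)
Section Iterators.
Variables (b : option nat) (G : nat -> nat -> option nat).
Fixpoint rec_it (n : nat) : option nat :=
  match n with
  | 0 => b
  | S n' => obind (rec_it n') (fun h => G n' h)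
  end.
Variable F : nat -> option nat.
Fixpoint mu_it (i c : nat) : option nat :=
  match c with
  | 0 => None
  | S c' =>
    match F i with
    | Some 0 => Some i
    | Some _ => mu_it (S i) c'
    | None => None
    end
  end.
End Iterators.

Lemma eval_rec k A f g x :
  eval (S k) A (PRec f g) x =
  rec_it (eval k A f (p1 x)) (fun n h => eval k A g (pr (p1 x) (pr n h))) (p2 x).
Proof. reflexivity. Qed.

Lemma eval_mu k A f x :
  eval (S k) A (PMu f) x = mu_it (fun i => eval k A f (pr x i)) 0 k.
Proof. reflexivity. Qed.

Lemma rec_it_mono b b' (G G' : nat -> nat -> option nat) :
  (forall y, b = Some y -> b' = Some y) ->
  (forall n h y, G n h = Some y -> G' n h = Some y) ->
  forall n y, rec_it b G n = Some y -> rec_it b' G' n = Some y.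
Proof.
  intros Hb HG n; induction n as [|n IH]; simpl; intros y H; [auto|].
  destruct (rec_it b G n) as [h|] eqn:E; simpl in H; [|discriminate].
  rewrite (IH h eq_refl); simpl; auto.
Qed.

Lemma mu_it_mono (F F' : nat -> option nat) :
  (forall i y, F i = Some y -> F' i = Some y) ->
  forall c c' i y, c <= c' -> mu_it F i c = Some y -> mu_it F' i c' = Some y.
Proof.
  intros HF c; induction c as [|c IH]; simpl; intros c' i y Hc H; [discriminate|].
  destruct c' as [|c']; [lia|]; simpl.
  destruct (F i) as [[|v]|] eqn:E; [| |discriminate];
    rewrite (HF _ _ E); [exact H|]; apply IH; [lia|exact H].
Qed.

Lemma eval_mono k : forall k' A p x y, k <= k' ->
  eval k A p x = Some y -> eval k' A p x = Some y.
Proof.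
  induction k as [|k IH]; intros k' A p x y Hk H; [discriminate|].
  destruct k' as [|k']; [lia|].
  assert (IH' : forall p x y, eval k A p x = Some y -> eval k' A p x = Some y)
    by (intros; apply IH; [lia|assumption]).
  destruct p as [| | | | | |f g|f g|f g|f]; try exact H.
  - simpl in *. destruct (eval k A g x) as [v|] eqn:E; simpl in H; [|discriminate].
    rewrite (IH' _ _ _ E); simpl; auto.
  - simpl in *. destruct (eval k A f x) as [v|] eqn:E; [|discriminate].
    destruct (eval k A g x) as [w|] eqn:E2; [|discriminate].
    now rewrite (IH' _ _ _ E), (IH' _ _ _ E2).
  - rewrite eval_rec in *; revert H; apply rec_it_mono; auto.
  - rewrite eval_mu in *; revert H; apply mu_it_mono; auto; lia.
Qed.

Lemma conv_det p A x y z : conv p A x y -> conv p A x z -> y = z.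
Proof.
  intros [k H] [l H'].
  apply (eval_mono _ (max k l)) in H; [|lia].
  apply (eval_mono _ (max k l)) in H'; [|lia]. congruence.
Qed.

Lemma conv_comp f g A x z y : conv g A x z -> conv f A z y -> conv (PComp f g) A x y.
Proof.
  intros [k H] [l H']; exists (S (max k l)); simpl.
  rewrite (eval_mono _ (max k l) _ _ _ _ (Nat.le_max_l _ _) H); simpl.
  exact (eval_mono _ _ _ _ _ _ (Nat.le_max_r _ _) H').
Qed.

Lemma conv_pair f g A x a b :
  conv f A x a -> conv g A x b -> conv (PPair f g) A x (pr a b).
Proof.
  intros [k H] [l H']; exists (S (max k l)); simpl.
  rewrite (eval_mono _ (max k l) _ _ _ _ (Nat.le_max_l _ _) H).
  now rewrite (eval_mono _ _ _ _ _ _ (Nat.le_max_r k l) H').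
Qed.

Lemma conv_rec0 f g A a y : conv f A a y -> conv (PRec f g) A (pr a 0) y.
Proof. intros [k H]; exists (S k); rewrite eval_rec, p1_pr, p2_pr; exact H. Qed.

Lemma conv_recS f g A a n h y :
  conv (PRec f g) A (pr a n) h -> conv g A (pr a (pr n h)) y ->
  conv (PRec f g) A (pr a (S n)) y.
Proof.
  intros [k H] [l H'].
  apply (eval_mono _ (S (max k l))) in H; [|lia].
  apply (eval_mono _ (max k l)) in H'; [|lia].
  exists (S (max k l)); rewrite eval_rec, p1_pr, p2_pr in *; simpl; now rewrite H.
Qed.

Lemma mu_it_found (F : nat -> option nat) i c :
  forall j, j <= i -> i < j + c -> F i = Some 0 ->
  (forall l, j <= l < i -> exists v, F l = Some (S v)) -> mu_it F j c = Some i.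
Proof.
  induction c as [|c IH]; intros j Hj Hc Hi Hl; [lia|]; simpl.
  destruct (Nat.eq_dec j i) as [->|]; [now rewrite Hi|].
  destruct (Hl j) as [v ->]; [lia|].
  apply IH; try lia; auto. intros l ?; apply Hl; lia.
Qed.

Lemma mu_it_inv (F : nat -> option nat) c :
  forall j i, mu_it F j c = Some i -> F i = Some 0.
Proof.
  induction c as [|c IH]; simpl; intros j i H; [discriminate|].
  destruct (F j) as [[|v]|] eqn:E; [congruence|eauto|discriminate].
Qed.

Lemma conv_mu f A x i :
  conv f A (pr x i) 0 -> (forall j, j < i -> exists v, conv f A (pr x j) (S v)) ->
  conv (PMu f) A x i.
Proof.
  intros [k Hk] Hj.
  assert (exists l, forall j, j < i -> exists v, eval l A f (pr x j) = Some (S v)) as [l Hl].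
  { clear Hk; induction i as [|i IH]; [exists 0; lia|].
    destruct IH as [l Hl]; [intros; apply Hj; lia|].
    destruct (Hj i) as [v [m Hm]]; [lia|].
    exists (max l m); intros j Hji; destruct (Nat.eq_dec j i) as [->|].
    - exists v; apply (eval_mono m); [lia|exact Hm].
    - destruct (Hl j) as [w Hw]; [lia|]; exists w; apply (eval_mono l); [lia|exact Hw]. }
  (* The fuel of [PMu] also bounds the number of candidates tried, hence the [S i]. *)
  set (m := max (S i) (max k l)). exists (S m); rewrite eval_mu.
  apply mu_it_found; [lia|lia|apply (eval_mono k); [lia|exact Hk]|].
  intros j Hji; destruct (Hl j) as [w Hw]; [lia|].
  exists w; apply (eval_mono l); [lia|exact Hw].
Qed.

Lemma conv_mu_inv f A x i : conv (PMu f) A x i -> conv f A (pr x i) 0.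
Proof.
  intros [[|k] H]; [discriminate|]; rewrite eval_mu in H.
  exists k; exact (mu_it_inv _ _ _ _ H).
Qed.

Lemma least_true (P : nat -> bool) n : P n = true ->
  exists m, m <= n /\ P m = true /\ forall j, j < m -> P j = false.
Proof.
  induction n as [n IH] using lt_wf_ind; intros Hn.
  destruct (excluded_middle_informative (exists j, j < n /\ P j = true)) as [[j [Hj Pj]]|Hno].
  - destruct (IH j Hj Pj) as [m [Hm ?]]; exists m; split; [lia|assumption].
  - exists n; repeat split; auto; intros j Hj.
    destruct (P j) eqn:E; [exfalso; eauto|reflexivity].
Qed.

Lemma halts_mu p A (F : nat -> bool) x :
  (forall t, conv p A (pr x t) (b2n (negb (F t)))) ->
  halts (PMu p) A x <-> exists t, F t = true.
Proof.
  intros Hp; split.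
  - intros [i Hi]; exists i. apply conv_mu_inv in Hi.
    pose proof (conv_det _ _ _ _ _ (Hp i) Hi); destruct (F i); [reflexivity|discriminate].
  - intros [t Ht]; destruct (least_true F t Ht) as [m [_ [Hm Hl]]].
    exists m; apply conv_mu.
    + generalize (Hp m); now rewrite Hm.
    + intros j Hj; exists 0; generalize (Hp j); now rewrite (Hl j Hj).
Qed.

Fixpoint subst_oracle (p q : prog) : prog :=
  match p with
  | POracle => q
  | PComp f g => PComp (subst_oracle f q) (subst_oracle g q)
  | PPair f g => PPair (subst_oracle f q) (subst_oracle g q)
  | PRec f g => PRec (subst_oracle f q) (subst_oracle g q)
  | PMu f => PMu (subst_oracle f q)
  | _ => p
  end.

Lemma mu_it_conv_inv (F : nat -> option nat) c :
  forall j i, mu_it F j c = Some i -> forall l, j <= l < i -> exists v, F l = Some (S v).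
Proof.
  induction c as [|c IH]; simpl; intros j i H l Hl; [discriminate|].
  destruct (F j) as [[|v]|] eqn:E; [injection H as ->; lia| |discriminate].
  destruct (Nat.eq_dec j l) as [->|]; [eauto|]. apply (IH _ _ H); lia.
Qed.

Lemma conv_subst A B q : (forall x, conv q B x (b2n (A x))) ->
  forall p x y, conv p A x y -> conv (subst_oracle p q) B x y.
Proof.
  intros Hq p x y [k H]; revert p x y H.
  induction k as [|k IH]; intros p x y H; [discriminate|].
  destruct p as [| | | | | |f g|f g|f g|f];
    try (exists 1; exact H).
  - simpl in H. injection H as <-. apply Hq.
  - simpl in H. destruct (eval k A g x) as [v|] eqn:E; simpl in H; [|discriminate].
    apply (conv_comp _ _ _ _ v); auto.
  - simpl in H. destruct (eval k A f x) as [v|] eqn:E; [|discriminate].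
    destruct (eval k A g x) as [w|] eqn:E2; [|discriminate].
    injection H as <-; apply conv_pair; auto.
  - rewrite eval_rec in H. rewrite <- (pr_eta x); simpl.
    revert y H; induction (p2 x) as [|n IHn]; simpl; intros y H.
    + apply conv_rec0; auto.
    + destruct (rec_it _ _ n) as [h|] eqn:E; simpl in H; [|discriminate].
      apply (conv_recS _ _ _ _ _ h); auto.
  - rewrite eval_mu in H; simpl. apply conv_mu.
    + apply IH. exact (mu_it_inv _ _ _ _ H).
    + intros j Hj. destruct (mu_it_conv_inv _ _ _ _ H j) as [v Hv]; [lia|].
      exists v; apply IH; exact Hv.
Qed.

(** * Functions computable uniformly in a family of oracles *)

(** A single program must serve every [i], which it sees only through the oracle [o i]. With
    [I := set] this expresses a Turing functional, with [I := unit] computability from one fixed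
    oracle. *)
Definition comp {I} (o : I -> set) (F : I -> nat -> nat) : Prop :=
  exists p, forall i x, conv p (o i) x (F i x).

Definition compb {I} (o : I -> set) (F : I -> nat -> bool) : Prop :=
  comp o (fun i x => b2n (F i x)).

Definition comp2 {I} (o : I -> set) (F : I -> nat -> nat -> nat) : Prop :=
  comp o (fun i x => F i (p1 x) (p2 x)).

Definition compb2 {I} (o : I -> set) (F : I -> nat -> nat -> bool) : Prop :=
  compb o (fun i x => F i (p1 x) (p2 x)).

Section Closure.
Context {I : Type} (o : I -> set).

Lemma comp_ext F G : comp o F -> (forall i x, F i x = G i x) -> comp o G.
Proof. intros [p Hp] H; exists p; intros; rewrite <- H; apply Hp. Qed.

Lemma comp_id : comp o (fun _ x => x).
Proof. exists PId; intros; exists 1; reflexivity. Qed.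

Lemma comp_app F g : comp o F -> comp o g -> comp o (fun i x => F i (g i x)).
Proof. intros [p Hp] [q Hq]; exists (PComp p q); intros; eapply conv_comp; eauto. Qed.

Lemma comp_S f : comp o f -> comp o (fun i x => S (f i x)).
Proof. apply (comp_app (fun _ x => S x)); exists PSucc; intros; exists 1; reflexivity. Qed.

Lemma comp_const n : comp o (fun _ _ => n).
Proof.
  induction n as [|n IH]; [exists PZero; intros; exists 1; reflexivity|].
  exact (comp_S _ IH).
Qed.

Lemma comp_p1 f : comp o f -> comp o (fun i x => p1 (f i x)).
Proof. apply (comp_app (fun _ x => p1 x)); exists PFst; intros; exists 1; reflexivity. Qed.

Lemma comp_p2 f : comp o f -> comp o (fun i x => p2 (f i x)).
Proof. apply (comp_app (fun _ x => p2 x)); exists PSnd; intros; exists 1; reflexivity. Qed.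

Lemma comp_pr f g : comp o f -> comp o g -> comp o (fun i x => pr (f i x) (g i x)).
Proof. intros [p Hp] [q Hq]; exists (PPair p q); intros; apply conv_pair; auto. Qed.

Lemma compb_oracle f : comp o f -> compb o (fun i x => o i (f i x)).
Proof.
  apply (comp_app (fun i x => b2n (o i x))); exists POracle; intros; exists 1; reflexivity.
Qed.

Lemma compb_app F g : compb o F -> comp o g -> compb o (fun i x => F i (g i x)).
Proof. apply (comp_app (fun i x => b2n (F i x))). Qed.

Lemma comp2_app F f g :
  comp2 o F -> comp o f -> comp o g -> comp o (fun i x => F i (f i x) (g i x)).
Proof.
  intros HF Hf Hg.
  apply (comp_ext (fun i x => (fun i z => F i (p1 z) (p2 z)) i (pr (f i x) (g i x)))).
  - apply (comp_app (fun i z => F i (p1 z) (p2 z))); [exact HF|now apply comp_pr].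
  - intros; cbv beta; now rewrite p1_pr, p2_pr.
Qed.

Lemma compb2_app F f g :
  compb2 o F -> comp o f -> comp o g -> compb o (fun i x => F i (f i x) (g i x)).
Proof. apply (comp2_app (fun i x y => b2n (F i x y))). Qed.

Lemma comp_rec n f (g : I -> nat -> nat -> nat -> nat) :
  comp o n -> comp o f ->
  comp o (fun i z => g i (p1 z) (p1 (p2 z)) (p2 (p2 z))) ->
  comp o (fun i x => nat_rect (fun _ => nat) (f i x) (g i x) (n i x)).
Proof.
  intros Hn [pf Hf] [pg Hg].
  assert (HR : comp2 o (fun i x m => nat_rect (fun _ => nat) (f i x) (g i x) m)).
  { exists (PRec pf pg); intros i x. rewrite <- (pr_eta x) at 1.
    generalize (p1 x); intros a; induction (p2 x) as [|m IH]; simpl.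
    - apply conv_rec0, Hf.
    - apply (conv_recS _ _ _ _ _ _ _ IH).
      generalize (Hg i (pr a (pr m (nat_rect (fun _ => nat) (f i a) (g i a) m)))).
      now rewrite !p1_pr, !p2_pr, p1_pr. }
  apply (comp2_app _ (fun _ x => x)); auto using comp_id.
Qed.

Lemma comp_iter n f (g : I -> nat -> nat -> nat) :
  comp o n -> comp o f -> comp2 o g ->
  comp o (fun i x => Nat.iter (n i x) (g i x) (f i x)).
Proof.
  intros Hn Hf Hg.
  apply (comp_ext (fun i x => nat_rect (fun _ => nat) (f i x) (fun _ h => g i x h) (n i x))).
  - apply comp_rec; auto. apply comp2_app; auto using comp_p1, comp_p2, comp_id.
  - intros; reflexivity.
Qed.

Lemma comp_if b f g :
  compb o b -> comp o f -> comp o g -> comp o (fun i x => if b i x then f i x else g i x).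
Proof.
  intros Hb Hf Hg.
  apply (comp_ext (fun i x => nat_rect (fun _ => nat) (g i x) (fun _ _ => f i x) (b2n (b i x)))).
  - apply comp_rec; auto. apply comp_app; auto using comp_p1, comp_id.
  - intros i x; destruct (b i x); reflexivity.
Qed.

Lemma comp_pred f : comp o f -> comp o (fun i x => pred (f i x)).
Proof.
  intros Hf. apply (comp_ext (fun i x => nat_rect (fun _ => nat) 0 (fun n _ => n) (f i x))).
  - apply comp_rec; auto using comp_const, comp_p1, comp_p2, comp_id.
  - intros i x; destruct (f i x); reflexivity.
Qed.

Lemma comp_add f g : comp o f -> comp o g -> comp o (fun i x => f i x + g i x).
Proof.
  intros Hf Hg. apply (comp_ext (fun i x => Nat.iter (f i x) S (g i x))).
  - apply comp_iter; auto. apply comp_S, comp_p2, comp_id.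
  - intros i x; induction (f i x); simpl; congruence.
Qed.

Lemma comp_sub f g : comp o f -> comp o g -> comp o (fun i x => f i x - g i x).
Proof.
  intros Hf Hg. apply (comp_ext (fun i x => Nat.iter (g i x) pred (f i x))).
  - apply comp_iter; auto. apply comp_pred, comp_p2, comp_id.
  - intros i x; induction (g i x) as [|n IH]; simpl; [lia|]; rewrite IH; lia.
Qed.

Lemma comp_mul f g : comp o f -> comp o g -> comp o (fun i x => f i x * g i x).
Proof.
  intros Hf Hg. apply (comp_ext (fun i x => Nat.iter (f i x) (fun h => g i x + h) 0)).
  - apply comp_iter; auto using comp_const.
    apply (comp_add (fun i z => g i (p1 z)));
      [apply comp_app|]; auto using comp_p1, comp_p2, comp_id.
  - intros i x; induction (f i x); simpl; congruence.
Qed.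

Lemma comp_pow f g : comp o f -> comp o g -> comp o (fun i x => f i x ^ g i x).
Proof.
  intros Hf Hg. apply (comp_ext (fun i x => Nat.iter (g i x) (fun h => f i x * h) 1)).
  - apply comp_iter; auto using comp_const.
    apply (comp_mul (fun i z => f i (p1 z)));
      [apply comp_app|]; auto using comp_p1, comp_p2, comp_id.
  - intros i x; induction (g i x); simpl; congruence.
Qed.

Lemma compb_leb f g : comp o f -> comp o g -> compb o (fun i x => f i x <=? g i x).
Proof.
  intros Hf Hg. apply (comp_ext (fun i x => 1 - (f i x - g i x))).
  - auto using comp_sub, comp_const.
  - intros i x; destruct (Nat.leb_spec (f i x) (g i x)); unfold b2n; lia.
Qed.

Lemma compb_ltb f g : comp o f -> comp o g -> compb o (fun i x => f i x <? g i x).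
Proof. intros; apply (compb_leb (fun i x => S (f i x))); auto using comp_S. Qed.

Lemma compb_ite (b c d : I -> nat -> bool) :
  compb o b -> compb o c -> compb o d -> compb o (fun i x => if b i x then c i x else d i x).
Proof.
  intros Hb Hc Hd.
  apply (comp_ext (fun i x => if b i x then b2n (c i x) else b2n (d i x))).
  - now apply comp_if.
  - intros i x; now destruct (b i x).
Qed.

Lemma compb_const c : compb o (fun _ _ => c).
Proof. exact (comp_const (b2n c)). Qed.

Lemma compb_ext F G : compb o F -> (forall i x, F i x = G i x) -> compb o G.
Proof. intros HF H; apply (comp_ext _ _ HF); intros; now rewrite H. Qed.

Lemma compb_and b c : compb o b -> compb o c -> compb o (fun i x => b i x && c i x).
Proof. intros; apply (compb_ite b c (fun _ _ => false)); auto using compb_const. Qed.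

Lemma compb_or b c : compb o b -> compb o c -> compb o (fun i x => b i x || c i x).
Proof. intros; apply (compb_ite b (fun _ _ => true) c); auto using compb_const. Qed.

Lemma compb_neg b : compb o b -> compb o (fun i x => negb (b i x)).
Proof.
  intros; apply (compb_ite b (fun _ _ => false) (fun _ _ => true)); auto using compb_const.
Qed.

Lemma compb_eqb f g : comp o f -> comp o g -> compb o (fun i x => f i x =? g i x).
Proof.
  intros Hf Hg. apply (compb_ext (fun i x => (f i x <=? g i x) && (g i x <=? f i x))).
  - auto using compb_and, compb_leb.
  - intros i x. destruct (Nat.leb_spec (f i x) (g i x)), (Nat.leb_spec (g i x) (f i x)),
      (Nat.eqb_spec (f i x) (g i x)); simpl; lia.
Qed.

Lemma compb_beq b c : compb o b -> compb o c -> compb o (fun i x => eqb (b i x) (c i x)).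
Proof.
  intros Hb Hc.
  apply (compb_ext (fun i x => if b i x then c i x else negb (c i x))).
  - apply compb_ite; auto using compb_neg.
  - intros i x; now destruct (b i x), (c i x).
Qed.

Lemma comp_b2n b : compb o b -> comp o (fun i x => b2n (b i x)).
Proof. auto. Qed.

End Closure.

(** * Bounded quantifiers, finite sets as numbers, bounded search *)

Definition allb (n : nat) (P : nat -> bool) : bool :=
  nat_rect (fun _ => bool) true (fun j acc => P j && acc) n.

Definition exb (n : nat) (P : nat -> bool) : bool := negb (allb n (fun j => negb (P j))).

Lemma allb_spec n P : allb n P = true <-> forall j, j < n -> P j = true.
Proof.
  unfold allb; induction n as [|n IH]; simpl; [split; [lia|auto]|].
  rewrite andb_true_iff, IH; split.
  - intros [H1 H2] j Hj; destruct (Nat.eq_dec j n) as [->|]; [auto|apply H2; lia].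
  - intros H; split; [apply H; lia|intros j Hj; apply H; lia].
Qed.

Lemma allb_false n P : allb n P = false <-> exists j, j < n /\ P j = false.
Proof.
  destruct (allb n P) eqn:E; split; try discriminate; auto.
  - rewrite allb_spec in E. intros [j [Hj Pj]]. rewrite (E j Hj) in Pj; discriminate.
  - intros _. apply NNPP; intros Hn. assert (allb n P = true); [|congruence].
    apply allb_spec; intros j Hj; destruct (P j) eqn:Pj; [reflexivity|exfalso; eauto].
Qed.

Lemma exb_spec n P : exb n P = true <-> exists j, j < n /\ P j = true.
Proof.
  unfold exb; rewrite negb_true_iff, allb_false; split;
    intros [j [Hj H]]; exists j; split; auto; now apply negb_false_iff.
Qed.

Lemma exb_false n P : exb n P = false <-> forall j, j < n -> P j = false.
Proof.
  unfold exb; rewrite negb_false_iff, allb_spec; split; intros H j Hj;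
    specialize (H j Hj); now apply negb_true_iff.
Qed.

(* Finite sets of numbers are coded by the binary digits of a number. *)
Definition bit (a n : nat) : bool := Nat.testbit a n.

Definition cnum (A : set) (n : nat) : nat :=
  nat_rect (fun _ => nat) 0 (fun j h => h + b2n (A j) * 2 ^ j) n.

(** The outermost step tests 0, so smaller witnesses override larger ones; the default is [n]. *)
Definition leastb (n : nat) (P : nat -> bool) : nat :=
  nat_rect (fun _ => nat) n (fun j h => if P (n - S j) then n - S j else h) n.

Lemma bit_add_high a n i : a < 2 ^ n -> bit (a + 2 ^ n) i = if i =? n then true else bit a i.
Proof.
  intros Ha; unfold bit.
  destruct (Nat.eqb_spec i n) as [->|Hi].
  - replace (a + 2 ^ n) with (a + 1 * 2 ^ n) by lia.
    rewrite Nat.testbit_eqb, Nat.div_add, Nat.div_small by (auto; apply Nat.pow_nonzero; lia).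
    reflexivity.
  - destruct (Nat.lt_total i n) as [H|[H|H]]; [|contradiction|].
    + rewrite !Nat.testbit_eqb. replace n with (i + S (n - S i)) by lia.
      rewrite Nat.pow_add_r, Nat.pow_succ_r', Nat.mul_comm.
      rewrite Nat.div_add by (apply Nat.pow_nonzero; lia).
      rewrite Nat.mul_comm with (n := 2), Nat.Div0.mod_add; reflexivity.
    + assert (H2 : 2 ^ S n <= 2 ^ i) by (apply Nat.pow_le_mono_r; lia).
      simpl in H2. rewrite !Nat.testbit_eqb, !Nat.div_small by lia. reflexivity.
Qed.

Lemma cnum_lt A n : cnum A n < 2 ^ n.
Proof.
  induction n as [|n IH]; simpl; [lia|]. fold (cnum A n). destruct (A n); simpl; lia.
Qed.

Lemma bit_cnum A n i : bit (cnum A n) i = (i <? n) && A i.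
Proof.
  induction n as [|n IH]; simpl.
  - apply Nat.bits_0.
  - fold (cnum A n). destruct (A n) eqn:E; simpl.
    + rewrite Nat.add_0_r, bit_add_high, IH by apply cnum_lt.
      destruct (Nat.eqb_spec i n) as [->|].
      * rewrite E; destruct (Nat.ltb_spec n (S n)); [reflexivity|lia].
      * destruct (Nat.ltb_spec i n), (Nat.ltb_spec i (S n)); simpl; auto; lia.
    + rewrite Nat.add_0_r, IH.
      destruct (Nat.ltb_spec i n), (Nat.ltb_spec i (S n)); simpl; auto; try lia.
      now replace i with n by lia.
Qed.

Lemma bit_high a n i : a < 2 ^ n -> n <= i -> bit a i = false.
Proof.
  intros Ha Hi; unfold bit. rewrite Nat.testbit_eqb, Nat.div_small; [reflexivity|].
  pose proof (Nat.pow_le_mono_r 2 n i); lia.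
Qed.

Lemma leastb_spec n P : (exists j, j < n /\ P j = true) ->
  leastb n P < n /\ P (leastb n P) = true.
Proof.
  intros [j [Hj Pj]]. unfold leastb.
  assert (H : forall m, m <= n -> n - m <= j ->
    let h := nat_rect (fun _ => nat) n (fun j h => if P (n - S j) then n - S j else h) m in
    h < n /\ P h = true).
  { induction m as [|m IH]; intros Hm Hj'; simpl; [lia|].
    destruct (P (n - S m)) eqn:E; [split; [lia|assumption]|].
    apply IH; [lia|]. destruct (Nat.eq_dec (n - S m) j); [congruence|lia]. }
  apply H; lia.
Qed.

Section Closure2.
Context {I : Type} (o : I -> set).

Lemma compb_allb n (P : I -> nat -> nat -> bool) :
  comp o n -> compb2 o P -> compb o (fun i x => allb (n i x) (P i x)).
Proof.
  intros Hn HP.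
  apply (comp_ext _ (fun i x => nat_rect (fun _ => nat) 1
           (fun j h => if P i x j then h else 0) (n i x))).
  - apply comp_rec; auto using comp_const. apply comp_if; auto using comp_const, comp_p2, comp_id.
    apply compb2_app; auto using comp_p1, comp_p2, comp_id.
  - intros i x; unfold allb; induction (n i x) as [|m IH]; simpl; [reflexivity|].
    rewrite IH; now destruct (P i x m).
Qed.

Lemma compb_exb n (P : I -> nat -> nat -> bool) :
  comp o n -> compb2 o P -> compb o (fun i x => exb (n i x) (P i x)).
Proof.
  intros Hn HP. apply compb_neg, (compb_allb n (fun i x j => negb (P i x j))); auto.
  apply (compb_neg o (fun i z => P i (p1 z) (p2 z))); auto.
Qed.

Lemma comp_cnum n (A : I -> nat -> nat -> bool) :
  comp o n -> compb2 o A -> comp o (fun i x => cnum (A i x) (n i x)).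
Proof.
  intros Hn HA; apply comp_rec; auto using comp_const.
  apply comp_add; [auto using comp_p2, comp_id|]. apply comp_mul.
  - apply comp_b2n, compb2_app; auto using comp_p1, comp_p2, comp_id.
  - apply comp_pow; auto using comp_const, comp_p1, comp_p2, comp_id.
Qed.

Lemma comp_leastb n (P : I -> nat -> nat -> bool) :
  comp o n -> compb2 o P -> comp o (fun i x => leastb (n i x) (P i x)).
Proof.
  intros Hn HP; apply comp_rec; auto.
  assert (comp o (fun i z => n i (p1 z) - S (p1 (p2 z)))).
  { apply comp_sub; [apply comp_app|]; auto using comp_S, comp_p1, comp_p2, comp_id. }
  apply comp_if; auto using comp_p2, comp_id.
  apply compb2_app; auto using comp_p1, comp_p2, comp_id.
Qed.

Lemma comp_div2 f : comp o f -> comp o (fun i x => Nat.div2 (f i x)).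
Proof.
  intros Hf.
  (* Iterating (a, b) -> (b, a + 1) from (0, 0) runs through the pairs ([div2 n], [div2 (S n)]). *)
  apply (comp_ext _ (fun i x => p1 (Nat.iter (f i x) (fun h => pr (p2 h) (S (p1 h))) (pr 0 0)))).
  - apply comp_p1, comp_iter; auto using comp_const.
    apply comp_pr; auto using comp_S, comp_p1, comp_p2, comp_id.
  - intros i x; generalize (f i x); intros n.
    assert (H : Nat.iter n (fun h => pr (p2 h) (S (p1 h))) (pr 0 0)
                = pr (Nat.div2 n) (Nat.div2 (S n))).
    { induction n as [|n IH]; [reflexivity|].
      change (Nat.iter (S n) ?g ?z) with (g (Nat.iter n g z)).
      rewrite IH, p1_pr, p2_pr; reflexivity. }
    rewrite H; apply p1_pr.
Qed.

Lemma compb_odd f : comp o f -> compb o (fun i x => Nat.odd (f i x)).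
Proof.
  intros Hf.
  apply (comp_ext _ (fun i x => Nat.iter (f i x) (fun h => 1 - h) 0)).
  - apply comp_iter; auto using comp_const.
    apply comp_sub; auto using comp_const, comp_p2, comp_id.
  - intros i x; induction (f i x) as [|n IH]; [reflexivity|].
    change (Nat.iter (S n) ?g ?z) with (g (Nat.iter n g z)).
    rewrite IH, Nat.odd_succ, <- Nat.negb_odd; now destruct (Nat.odd n).
Qed.

Lemma compb_bit a n : comp o a -> comp o n -> compb o (fun i x => bit (a i x) (n i x)).
Proof.
  intros Ha Hn. apply (compb_ext _ (fun i x => Nat.odd (Nat.iter (n i x) Nat.div2 (a i x)))).
  - apply compb_odd, comp_iter; auto. apply comp_div2; auto using comp_p2, comp_id.
  - intros i x; unfold bit. generalize (a i x); induction (n i x) as [|m IH]; intros b.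
    + reflexivity.
    + rewrite Nat.iter_succ_r; apply IH.
Qed.

Lemma comp_mu (F : I -> nat -> nat -> bool) r :
  compb2 o F -> (forall i x, F i x (r i x) = true) ->
  (forall i x j, j < r i x -> F i x j = false) -> comp o r.
Proof.
  intros HF Hr Hl. assert (HN : compb2 o (fun i x j => negb (F i x j))) by now apply compb_neg.
  destruct HN as [p Hp]. exists (PMu p); intros i x; apply conv_mu.
  - generalize (Hp i (pr x (r i x))); now rewrite p1_pr, p2_pr, Hr.
  - intros j Hj; exists 0. generalize (Hp i (pr x j)); now rewrite p1_pr, p2_pr, Hl.
Qed.

End Closure2.

Lemma comp_oracle_trans {I} (o o' : I -> set) F :
  comp o' F -> compb o o' -> comp o F.
Proof.
  intros [p Hp] [q Hq]; exists (subst_oracle p q); intros i x.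
  apply (conv_subst (o' i)); auto.
Qed.

Lemma Treducible_comp A B :
  Treducible B A <-> compb (fun _ : unit => A) (fun _ => B).
Proof.
  split; intros [p Hp]; exists p; [intros _; exact Hp|exact (Hp tt)].
Qed.

(** * Automation: computability by recursion on the shape of a term *)

Ltac comp1 :=
  cbv beta;
  lazymatch goal with
  | |- compb2 _ _ => unfold compb2
  | |- comp2 _ _ => unfold comp2
  | |- compb _ (fun i x => Nat.eqb (@?f i x) (@?g i x)) => apply (compb_eqb _ f g)
  | |- compb _ (fun i x => Nat.ltb (@?f i x) (@?g i x)) => apply (compb_ltb _ f g)
  | |- compb _ (fun i x => Nat.leb (@?f i x) (@?g i x)) => apply (compb_leb _ f g)
  | |- compb _ (fun i x => eqb (@?f i x) (@?g i x)) => apply (compb_beq _ f g)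
  | |- compb _ (fun i x => andb (@?f i x) (@?g i x)) => apply (compb_and _ f g)
  | |- compb _ (fun i x => orb (@?f i x) (@?g i x)) => apply (compb_or _ f g)
  | |- compb _ (fun i x => negb (@?f i x)) => apply (compb_neg _ f)
  | |- compb _ (fun i x => if @?b i x then @?f i x else @?g i x) => apply (compb_ite _ b f g)
  | |- compb _ (fun i x => allb (@?n i x) (@?P i x)) => apply (compb_allb _ n P)
  | |- compb _ (fun i x => exb (@?n i x) (@?P i x)) => apply (compb_exb _ n P)
  | |- compb _ (fun i x => bit (@?n i x) (@?m i x)) => apply (compb_bit _ n m)
  | |- compb _ (fun _ _ => true) => apply compb_const
  | |- compb _ (fun _ _ => false) => apply compb_const
  | |- comp _ (fun i x => x) => apply comp_id
  | |- comp _ (fun i x => p1 (@?f i x)) => apply (comp_p1 _ f)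
  | |- comp _ (fun i x => p2 (@?f i x)) => apply (comp_p2 _ f)
  | |- comp _ (fun i x => S (@?f i x)) => apply (comp_S _ f)
  | |- comp _ (fun i x => pred (@?f i x)) => apply (comp_pred _ f)
  | |- comp _ (fun i x => pr (@?f i x) (@?g i x)) => apply (comp_pr _ f g)
  | |- comp _ (fun i x => Nat.add (@?f i x) (@?g i x)) => apply (comp_add _ f g)
  | |- comp _ (fun i x => Nat.sub (@?f i x) (@?g i x)) => apply (comp_sub _ f g)
  | |- comp _ (fun i x => Nat.mul (@?f i x) (@?g i x)) => apply (comp_mul _ f g)
  | |- comp _ (fun i x => Nat.pow (@?f i x) (@?g i x)) => apply (comp_pow _ f g)
  | |- comp _ (fun i x => b2n (@?f i x)) => apply (comp_b2n _ f)
  | |- comp _ (fun i x => if @?b i x then @?f i x else @?g i x) => apply (comp_if _ b f g)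
  | |- comp _ (fun i x => cnum (@?A i x) (@?n i x)) => apply (comp_cnum _ n A)
  | |- comp _ (fun i x => leastb (@?n i x) (@?P i x)) => apply (comp_leastb _ n P)
  | |- comp _ (fun i x => Nat.iter (@?n i x) (@?g i x) (@?f i x)) => apply (comp_iter _ n f g)
  | |- comp _ (fun i x => nat_rect _ (@?f i x) (@?g i x) (@?n i x)) => apply (comp_rec _ n f g)
  (* Last, because [?n] also matches terms in the bound variables. *)
  | |- comp _ (fun _ _ => ?n) => apply (comp_const _ n)
  end.

Ltac comp_hyp :=
  cbv beta;
  match goal with
  | H : comp ?o ?F |- comp ?o ?F => exact H
  | H : compb ?o ?F |- compb ?o ?F => exact H
  | H : comp ?o ?F |- comp ?o (fun i x => ?F i x) => exact H
  | H : compb ?o ?F |- compb ?o (fun i x => ?F i x) => exact H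
  | H : comp ?o ?F |- comp ?o (fun i x => ?F i (@?g i x)) => apply (comp_app o F g H)
  | H : compb ?o ?F |- compb ?o (fun i x => ?F i (@?g i x)) => apply (compb_app o F g H)
  | H : compb2 ?o ?F |- compb ?o (fun i x => ?F i (@?f i x) (@?g i x)) =>
      apply (compb2_app o F f g H)
  end.

Ltac comp_hook := fail.
Ltac comps_with h := repeat first [comp1 | comp_hyp | comp_hook | h].
Ltac comps := comps_with fail.

(** * A stack machine on program codes *)

(** [eval] recurses on the type [prog], whereas the closure lemmas concern functions of numbers. A
    machine whose [step] is a case distinction on numbers can be iterated within their reach and
    yields a universal computable function. *)
Definition Ev (c x K : nat) : nat := pr K (pr 0 (pr c x)).
Definition Rt (y K : nat) : nat := pr K (pr 1 y).
(** The successor reserves 0 for the empty stack. Frame tags: 0 holds the outer program of a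
    composition, 1 the second half of a pair still to be run, 2 the value of its first half, 3 a
    recursion at stage [j] of [n], 4 a minimisation at candidate [i]. *)
Definition push (fr K : nat) : nat := S (pr fr K).

(* A machine state holds a stack [K] of frames and either a pending call [Ev c x K] or a returned
   value [Rt y K].  Oracle queries at or beyond [L] get stuck, so that only a finite part of the
   oracle matters. *)
Definition step (A : set) (L s : nat) : nat :=
  let K := p1 s in
  let d := p2 (p2 s) in
  if p1 (p2 s) =? 0 then
    let c := p1 d in let x := p2 d in let tag := p1 c in let a := p2 c in
    if tag =? 0 then Rt 0 K
    else if tag =? 1 then Rt (S x) K
    else if tag =? 2 then Rt x K
    else if tag =? 3 then Rt (p1 x) K
    else if tag =? 4 then Rt (p2 x) K
    else if tag =? 5 then (if x <? L then Rt (b2n (A x)) K else s)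
    else if tag =? 6 then Ev (p2 a) x (push (pr 0 (p1 a)) K)
    else if tag =? 7 then Ev (p1 a) x (push (pr 1 (pr (p2 a) x)) K)
    else if tag =? 8 then
      Ev (p1 a) (p1 x) (push (pr 3 (pr (pr (p2 a) (p1 x)) (pr 0 (p2 x)))) K)
    else Ev a (pr x 0) (push (pr 4 (pr a (pr x 0))) K)
  else if K =? 0 then s
  else
    let ft := p1 (p1 (pred K)) in let b := p2 (p1 (pred K)) in let K' := p2 (pred K) in
    if ft =? 0 then Ev b d K'
    else if ft =? 1 then Ev (p1 b) (p2 b) (push (pr 2 d) K')
    else if ft =? 2 then Rt (pr b d) K'
    else if ft =? 3 then
      let g := p1 (p1 b) in let a := p2 (p1 b) in let j := p1 (p2 b) in let n := p2 (p2 b) in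
      if j =? n then Rt d K'
      else Ev g (pr a (pr j d)) (push (pr 3 (pr (pr g a) (pr (S j) n))) K')
    else
      let f := p1 b in let x := p1 (p2 b) in let i := p2 (p2 b) in
      if d =? 0 then Rt i K'
      else Ev f (pr x (S i)) (push (pr 4 (pr f (pr x (S i)))) K').

Definition run (A : set) (L n s : nat) : nat := Nat.iter n (step A L) s.

Definition out (s : nat) : nat :=
  if (p1 s =? 0) && (p1 (p2 s) =? 1) then S (p2 (p2 s)) else 0.

(* One more than the output, or 0 if there is none within [t] steps and oracle queries below [t]. *)
Definition U (A : set) (t c x : nat) : nat := out (run A t t (Ev c x 0)).

(** Only an oracle query can tell the two machines apart. A query at or beyond [L] leaves the first
    one in a pending call forever, which [out] reads as no output. *)
Lemma step_agree A A' L L' s :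
  (forall x, x < L -> A x = A' x) -> L <= L' ->
  step A L s = step A' L' s \/ (step A L s = s /\ p1 (p2 s) = 0).
Proof.
  intros HA HL. unfold step.
  destruct (Nat.eqb_spec (p1 (p2 s)) 0) as [E|]; [|auto].
  destruct (p1 (p1 (p2 (p2 s))) =? 0); auto.
  destruct (p1 (p1 (p2 (p2 s))) =? 1); auto.
  destruct (p1 (p1 (p2 (p2 s))) =? 2); auto.
  destruct (p1 (p1 (p2 (p2 s))) =? 3); auto.
  destruct (p1 (p1 (p2 (p2 s))) =? 4); auto.
  destruct (p1 (p1 (p2 (p2 s))) =? 5); auto.
  destruct (Nat.ltb_spec (p2 (p2 (p2 s))) L); auto.
  destruct (Nat.ltb_spec (p2 (p2 (p2 s))) L'); [|lia].
  rewrite HA; auto.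
Qed.

Lemma iter_fix {X} (f : X -> X) s n : f s = s -> Nat.iter n f s = s.
Proof. intros H; induction n as [|n IH]; simpl; congruence. Qed.

Lemma run_agree A A' L L' n : (forall x, x < L -> A x = A' x) -> L <= L' ->
  forall s, out (run A L n s) <> 0 -> run A' L' n s = run A L n s.
Proof.
  intros HA HL; induction n as [|n IH]; intros s H; [reflexivity|].
  unfold run in *; rewrite Nat.iter_succ_r in H |- *; rewrite Nat.iter_succ_r.
  destruct (step_agree A A' L L' s HA HL) as [E|[E F]].
  - rewrite <- E; apply IH, H.
  - rewrite E, iter_fix in H by exact E. unfold out in H. rewrite F in H.
    now rewrite andb_false_r in H.
Qed.

Lemma step_final A L s : out s <> 0 -> step A L s = s.
Proof.
  unfold out, step; intros H.
  destruct (p1 (p2 s)); [now rewrite andb_false_r in H|]; simpl.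
  now destruct (p1 s =? 0).
Qed.

Lemma run_add A L n m s : run A L (n + m) s = run A L n (run A L m s).
Proof. apply Nat.iter_add. Qed.

(** The use principle: [t] bounds both time and queries, so agreement below [t] reproduces the run,
    and a finished state is a fixed point of [step]. *)
Lemma U_mono A A' t t' c x y : (forall i, i < t -> A i = A' i) -> t <= t' ->
  U A t c x = S y -> U A' t' c x = S y.
Proof.
  unfold U; intros HA Ht H.
  replace t' with ((t' - t) + t) at 2 by lia.
  rewrite run_add, (run_agree A A' t t' t) by (auto; congruence).
  unfold run at 1; rewrite iter_fix; [exact H|].
  apply step_final; congruence.
Qed.

Lemma step_Rt A L y fr K : step A L (Rt y (push fr K)) =
  if p1 fr =? 0 then Ev (p2 fr) y K
  else if p1 fr =? 1 then Ev (p1 (p2 fr)) (p2 (p2 fr)) (push (pr 2 y) K)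
  else if p1 fr =? 2 then Rt (pr (p2 fr) y) K
  else if p1 fr =? 3 then
    let b := p2 fr in
    let g := p1 (p1 b) in let a := p2 (p1 b) in let j := p1 (p2 b) in let n := p2 (p2 b) in
    if j =? n then Rt y K
    else Ev g (pr a (pr j y)) (push (pr 3 (pr (pr g a) (pr (S j) n))) K)
  else
    let b := p2 fr in
    let f := p1 b in let x := p1 (p2 b) in let i := p2 (p2 b) in
    if y =? 0 then Rt i K
    else Ev f (pr x (S i)) (push (pr 4 (pr f (pr x (S i)))) K).
Proof.
  unfold step. cbv zeta.
  assert (E1 : p1 (Rt y (push fr K)) = push fr K) by (unfold Rt; now rewrite p1_pr).
  assert (E2 : p2 (Rt y (push fr K)) = pr 1 y) by (unfold Rt; now rewrite p2_pr).
  assert (E3 : pred (push fr K) = pr fr K) by reflexivity.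
  assert (E4 : push fr K =? 0 = false) by reflexivity.
  rewrite E1, E2, E3, E4, ?p1_pr, ?p2_pr. reflexivity.
Qed.

Lemma step_Ev A L c x K : step A L (Ev c x K) =
    let tag := p1 c in let a := p2 c in
    if tag =? 0 then Rt 0 K
    else if tag =? 1 then Rt (S x) K
    else if tag =? 2 then Rt x K
    else if tag =? 3 then Rt (p1 x) K
    else if tag =? 4 then Rt (p2 x) K
    else if tag =? 5 then (if x <? L then Rt (b2n (A x)) K else Ev c x K)
    else if tag =? 6 then Ev (p2 a) x (push (pr 0 (p1 a)) K)
    else if tag =? 7 then Ev (p1 a) x (push (pr 1 (pr (p2 a) x)) K)
    else if tag =? 8 then
      Ev (p1 a) (p1 x) (push (pr 3 (pr (pr (p2 a) (p1 x)) (pr 0 (p2 x)))) K)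
    else Ev a (pr x 0) (push (pr 4 (pr a (pr x 0))) K).
Proof.
  unfold step. cbv zeta.
  assert (E1 : p1 (Ev c x K) = K) by (unfold Ev; now rewrite p1_pr).
  assert (E2 : p2 (Ev c x K) = pr 0 (pr c x)) by (unfold Ev; now rewrite p2_pr).
  rewrite E1, E2, ?p1_pr, ?p2_pr, ?p1_pr, ?p2_pr. reflexivity.
Qed.

Ltac stepE := cbn [code]; rewrite step_Ev; cbv zeta; rewrite ?p1_pr, ?p2_pr;
  cbn [Nat.eqb]; rewrite ?p1_pr, ?p2_pr.
Ltac stepR := rewrite step_Rt; cbv zeta; rewrite ?p1_pr, ?p2_pr; cbn [Nat.eqb];
  rewrite ?p1_pr, ?p2_pr, ?p1_pr, ?p2_pr, ?p1_pr, ?p2_pr.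

Definition reach (A : set) (s s' : nat) : Prop :=
  exists n L, forall L', L <= L' -> run A L' n s = s'.

Lemma reach_trans A s s' s'' : reach A s s' -> reach A s' s'' -> reach A s s''.
Proof.
  intros [n [L H]] [n' [L1 H']]. exists (n' + n), (max L L1); intros L' HL.
  rewrite run_add, H, H'; [reflexivity|lia|lia].
Qed.

Lemma reach_step A s s' L : (forall L', L <= L' -> step A L' s = s') -> reach A s s'.
Proof. intros H; exists 1, L; intros L' HL; simpl; auto. Qed.

(** The stack [K] is arbitrary because subcomputations run on top of a pushed frame; this puts them
    within the induction hypothesis. *)
Lemma reach_eval A k : forall p x y, eval k A p x = Some y ->
  forall K, reach A (Ev (code p) x K) (Rt y K).
Proof.
  induction k as [|k IH]; intros p x y H K; [discriminate|].
  destruct p as [| | | | | |f g|f g|f g|f].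
  1-5: simpl in H; injection H as <-;
    apply (reach_step _ _ _ 0); intros L' _; stepE; reflexivity.
  - simpl in H; injection H as <-.
    apply (reach_step _ _ _ (S x)); intros L' HL; stepE.
    destruct (Nat.ltb_spec x L'); [reflexivity|lia].
  - simpl in H. destruct (eval k A g x) as [v|] eqn:E; simpl in H; [|discriminate].
    eapply reach_trans; [apply (reach_step _ _ _ 0); intros L' _; stepE; reflexivity|].
    eapply reach_trans; [apply IH, E|].
    eapply reach_trans; [apply (reach_step _ _ _ 0); intros L' _; stepR; reflexivity|].
    apply IH, H.
  - simpl in H. destruct (eval k A f x) as [v|] eqn:E; [|discriminate].
    destruct (eval k A g x) as [w|] eqn:E2; [|discriminate]. injection H as <-.
    eapply reach_trans; [apply (reach_step _ _ _ 0); intros L' _; stepE; reflexivity|].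
    eapply reach_trans; [apply IH, E|].
    eapply reach_trans; [apply (reach_step _ _ _ 0); intros L' _; stepR; reflexivity|].
    eapply reach_trans; [apply IH, E2|].
    apply (reach_step _ _ _ 0); intros L' _; stepR; reflexivity.
  - rewrite eval_rec in H.
    eapply reach_trans; [apply (reach_step _ _ _ 0); intros L' _; stepE; reflexivity|].
    set (a := p1 x) in *; set (N := p2 x) in *.
    assert (HR : forall n h, n <= N ->
      rec_it (eval k A f a) (fun n h => eval k A g (pr a (pr n h))) n = Some h ->
      reach A (Ev (code f) a (push (pr 3 (pr (pr (code g) a) (pr 0 N))) K))
              (Rt h (push (pr 3 (pr (pr (code g) a) (pr n N))) K))).
    { induction n as [|n IHn]; simpl; intros h Hn Hh; [apply IH, Hh|].
      destruct (rec_it _ _ n) as [h'|] eqn:E; simpl in Hh; [|discriminate].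
      eapply reach_trans; [apply (IHn h'); [lia|reflexivity]|].
      eapply reach_trans; [|apply IH, Hh].
      apply (reach_step _ _ _ 0); intros L' _; stepR.
      destruct (Nat.eqb_spec n N); [lia|reflexivity]. }
    eapply reach_trans; [apply (HR N y); [lia|exact H]|].
    apply (reach_step _ _ _ 0); intros L' _; stepR. now rewrite Nat.eqb_refl.
  - rewrite eval_mu in H.
    eapply reach_trans; [apply (reach_step _ _ _ 0); intros L' _; stepE; reflexivity|].
    assert (HM : forall c i, mu_it (fun i => eval k A f (pr x i)) i c = Some y ->
      reach A (Ev (code f) (pr x i) (push (pr 4 (pr (code f) (pr x i))) K)) (Rt y K));
      [|exact (HM k 0 H)].
    clear H; induction c as [|c IHc]; cbn [mu_it]; intros i H; [discriminate|].
    destruct (eval k A f (pr x i)) as [[|v]|] eqn:E; [| |discriminate];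
      (eapply reach_trans; [apply IH, E|]).
    + injection H as ->. apply (reach_step _ _ _ 0); intros L' _; stepR. reflexivity.
    + eapply reach_trans; [|apply IHc, H].
      apply (reach_step _ _ _ 0); intros L' _; stepR. reflexivity.
Qed.

Lemma U_complete p A x y : conv p A x y -> exists t, U A t (code p) x = S y.
Proof.
  intros [k H]. destruct (reach_eval A k p x y H 0) as [n [L HL]].
  exists (max n L); unfold U.
  replace (max n L) with ((max n L - n) + n) at 2 by lia.
  rewrite run_add, HL by lia.
  unfold run; rewrite iter_fix.
  - unfold out, Rt; rewrite p1_pr, ?p2_pr, ?p1_pr, ?p2_pr; reflexivity.
  - apply step_final; unfold out, Rt; rewrite p1_pr, ?p2_pr, ?p1_pr; discriminate.
Qed.

Lemma Ev_neq_Rt c x K v K' : Ev c x K <> Rt v K'.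
Proof.
  intros H. apply (f_equal (fun s => p1 (p2 s))) in H.
  unfold Ev, Rt in H; rewrite ?p2_pr, ?p1_pr in H; discriminate.
Qed.

Lemma run_S A L n s : run A L (S n) s = run A L n (step A L s).
Proof. apply Nat.iter_succ_r. Qed.

(** The run ends with an empty stack, so every frame pushed on the way has to be popped, which
    forces each subcall to return. The number [m] of remaining steps lets strong induction on the
    length continue with the next subcall. *)
Lemma run_sound A L n : forall p x K v, run A L n (Ev (code p) x K) = Rt v 0 ->
  exists y m, m < n /\ conv p A x y /\ run A L m (Rt y K) = Rt v 0.
Proof.
  induction n as [n IH] using lt_wf_ind; intros p x K v H.
  destruct n as [|n]; [exfalso; exact (Ev_neq_Rt _ _ _ _ _ H)|].
  rewrite run_S in H. revert H.
  destruct p as [| | | | | |f g|f g|f g|f]; stepE; intros H.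
  1-5: (eexists; exists n; repeat split; [lia| |exact H]; exists 1; reflexivity).
  - destruct (Nat.ltb_spec x L).
    + exists (b2n (A x)), n; repeat split; [lia| |exact H]; exists 1; reflexivity.
    + exfalso. unfold run in H; rewrite iter_fix in H.
      * exact (Ev_neq_Rt _ _ _ _ _ H).
      * rewrite step_Ev; cbv zeta; rewrite p1_pr; cbn [Nat.eqb].
        destruct (Nat.ltb_spec x L); [lia|reflexivity].
  - apply IH in H as [z [m [Hm [Hg H]]]]; [|lia].
    destruct m as [|m].
    { exfalso; revert H; simpl; unfold Rt, push; intros H.
      apply (f_equal p1) in H; rewrite !p1_pr in H; discriminate. }
    rewrite run_S in H; revert H; stepR; intros H.
    apply IH in H as [y [m' [Hm' [Hf H]]]]; [|lia].
    exists y, m'; repeat split; [lia| |exact H]. eapply conv_comp; eauto.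
  - apply IH in H as [z [m [Hm [Hg H]]]]; [|lia].
    destruct m as [|m].
    { exfalso; revert H; simpl; unfold Rt, push; intros H.
      apply (f_equal p1) in H; rewrite !p1_pr in H; discriminate. }
    rewrite run_S in H; revert H; stepR; intros H.
    apply IH in H as [y [m' [Hm' [Hf H]]]]; [|lia].
    destruct m' as [|m'].
    { exfalso; revert H; simpl; unfold Rt, push; intros H.
      apply (f_equal p1) in H; rewrite !p1_pr in H; discriminate. }
    rewrite run_S in H; revert H; stepR; intros H.
    exists (pr z y), m'; repeat split; [lia| |exact H]. now apply conv_pair.
  - apply IH in H as [z [m [Hm [Hf H]]]]; [|lia].
    apply (conv_rec0 f g) in Hf. pose proof (pr_eta x) as Ex.
    assert (Hmn : m <= n) by lia. clear Hm.
    set (a := p1 x) in *; set (N := p2 x) in *. clearbody a N. subst x.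
    enough (HR : forall m j z, m <= n -> conv (PRec f g) A (pr a j) z ->
      run A L m (Rt z (push (pr 3 (pr (pr (code g) a) (pr j N))) K)) = Rt v 0 ->
      exists y m', m' < S n /\ conv (PRec f g) A (pr a N) y /\ run A L m' (Rt y K) = Rt v 0)
      by exact (HR m 0 z Hmn Hf H).
    clear m z H Hf Hmn.
    induction m as [m IHm] using lt_wf_ind; intros j z Hmn Hj H.
    destruct m as [|m].
    { exfalso; revert H; simpl; unfold Rt, push; intros H.
      apply (f_equal p1) in H; rewrite !p1_pr in H; discriminate. }
    rewrite run_S in H; revert H; stepR; intros H.
    destruct (Nat.eqb_spec j N) as [->|_].
    { exists z, m; repeat split; [lia|exact Hj|exact H]. }
    apply IH in H as [y [m' [Hm' [Hg H]]]]; [|lia].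
    apply (IHm m') with (j := S j) (z := y); [lia|lia| |exact H].
    eapply conv_recS; eauto.
  - enough (HR : forall n' i, n' <= n ->
      (forall j, j < i -> exists w, conv f A (pr x j) (S w)) ->
      run A L n' (Ev (code f) (pr x i) (push (pr 4 (pr (code f) (pr x i))) K)) = Rt v 0 ->
      exists y m', m' < S n /\ conv (PMu f) A x y /\ run A L m' (Rt y K) = Rt v 0)
      by (apply (HR n 0); [lia|lia|exact H]).
    clear H. induction n' as [n' IHn] using lt_wf_ind; intros i Hn Hl H.
    apply IH in H as [z [m [Hm [Hf H]]]]; [|lia].
    destruct m as [|m].
    { exfalso; revert H; simpl; unfold Rt, push; intros H.
      apply (f_equal p1) in H; rewrite !p1_pr in H; discriminate. }
    rewrite run_S in H; revert H; stepR; intros H.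
    destruct z as [|z]; cbn [Nat.eqb] in H.
    { exists i, m; repeat split; [lia| |exact H]. now apply conv_mu. }
    apply (IHn m) with (i := S i); [lia|lia| |exact H].
    intros j Hj; destruct (Nat.eq_dec j i) as [->|]; [eauto|apply Hl; lia].
Qed.

Lemma out_Rt s y : out s = S y -> s = Rt y 0.
Proof.
  unfold out, Rt. intros H.
  destruct (Nat.eqb_spec (p1 s) 0) as [E|]; [|discriminate].
  destruct (Nat.eqb_spec (p1 (p2 s)) 1) as [E'|]; [|discriminate].
  injection H as <-.
  transitivity (pr (p1 s) (pr (p1 (p2 s)) (p2 (p2 s)))); [now rewrite !pr_eta|now rewrite E, E'].
Qed.

Lemma U_sound p A t x y : U A t (code p) x = S y -> conv p A x y.
Proof.
  intros H. apply out_Rt, run_sound in H as [z [m [_ [Hc H]]]].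
  unfold run in H; rewrite iter_fix in H.
  - unfold Rt in H. apply (f_equal (fun s => p2 (p2 s))) in H.
    rewrite !p2_pr in H; now subst.
  - apply step_final; unfold out, Rt; rewrite p1_pr, ?p2_pr, ?p1_pr; discriminate.
Qed.

(* Every component of a code is smaller, so the codes below [n] can be tabulated. *)
Definition code_check (T n : nat) : bool :=
  let tag := p1 n in let a := p2 n in
  if tag <? 6 then a =? 0
  else if tag <? 9 then bit T (p1 a) && bit T (p2 a)
  else if tag =? 9 then bit T a else false.

Definition code_table (n : nat) : nat :=
  nat_rect (fun _ => nat) 0 (fun j T => T + b2n (code_check T j) * 2 ^ j) n.

Definition is_code (n : nat) : bool := bit (code_table (S n)) n.

Lemma code_table_cnum n : code_table n = cnum is_code n.
Proof.
  induction n as [|n IH]; [reflexivity|].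
  simpl. fold (code_table n) (cnum is_code n). unfold is_code at 2.
  simpl; fold (code_table n). rewrite IH. do 2 f_equal.
  destruct (code_check (cnum is_code n) n); simpl; rewrite ?Nat.add_0_r.
  - rewrite bit_add_high, Nat.eqb_refl by apply cnum_lt; reflexivity.
  - rewrite bit_cnum; destruct (Nat.ltb_spec n n); [lia|reflexivity].
Qed.

Lemma is_code_unfold n : is_code n = code_check (cnum is_code n) n.
Proof.
  unfold is_code at 1. simpl; fold (code_table n). rewrite code_table_cnum.
  destruct (code_check (cnum is_code n) n); simpl; rewrite ?Nat.add_0_r.
  - rewrite bit_add_high, Nat.eqb_refl by apply cnum_lt; reflexivity.
  - rewrite bit_cnum; destruct (Nat.ltb_spec n n); [lia|reflexivity].
Qed.

Lemma is_code_spec n : is_code n = true <-> exists p, code p = n.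
Proof.
  split.
  - induction n as [n IH] using lt_wf_ind; rewrite is_code_unfold; unfold code_check.
    intros H. rewrite <- (pr_eta n).
    assert (Hn : p1 n + p2 n <= n) by (rewrite <- (pr_eta n) at 3; apply pr_ge).
    pose proof (pr_eta (p2 n)) as Ea. pose proof (pr_ge (p1 (p2 n)) (p2 (p2 n))) as Hle.
    rewrite Ea in Hle.
    destruct (Nat.ltb_spec (p1 n) 6) as [H6|H6].
    { apply Nat.eqb_eq in H; rewrite H.
      destruct (p1 n) as [|[|[|[|[|[|m]]]]]]; [..|lia].
      - exists PZero; reflexivity.
      - exists PSucc; reflexivity.
      - exists PId; reflexivity.
      - exists PFst; reflexivity.
      - exists PSnd; reflexivity.
      - exists POracle; reflexivity. }
    destruct (Nat.ltb_spec (p1 n) 9) as [H9|H9].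
    { rewrite !bit_cnum, !andb_true_iff in H. destruct H as [[_ H1] [_ H2]].
      apply IH in H1 as [f Hf]; [|lia]. apply IH in H2 as [g Hg]; [|lia].
      rewrite <- Ea, <- Hf, <- Hg.
      assert (p1 n = 6 \/ p1 n = 7 \/ p1 n = 8) as [-> |[-> | ->]] by lia.
      - exists (PComp f g); reflexivity.
      - exists (PPair f g); reflexivity.
      - exists (PRec f g); reflexivity. }
    destruct (Nat.eqb_spec (p1 n) 9) as [->|]; [|discriminate].
    rewrite bit_cnum, andb_true_iff in H. destruct H as [_ H].
    apply IH in H as [f Hf]; [|lia]. rewrite <- Hf; exists (PMu f); reflexivity.
  - intros [p <-].
    induction p as [| | | | | |f IHf g IHg|f IHf g IHg|f IHf g IHg|f IHf];
      rewrite is_code_unfold; unfold code_check; cbn [code];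
      rewrite ?p1_pr, ?p2_pr, ?p1_pr, ?p2_pr; try reflexivity; cbn [Nat.ltb Nat.leb Nat.eqb];
      rewrite !bit_cnum, ?IHf, ?IHg, ?andb_true_r, ?andb_true_iff.
    1-3: pose proof (pr_ge (code f) (code g)); split; apply Nat.ltb_lt;
      match goal with |- _ < pr ?a ?b => pose proof (pr_ge a b) end; lia.
    apply Nat.ltb_lt; pose proof (pr_ge 9 (code f)); lia.
Qed.

Definition halt_in (A : set) (t n : nat) : bool := is_code n && negb (U A t n n =? 0).

Lemma halt_in_mono A A' t t' n : (forall i, i < t -> A i = A' i) -> t <= t' ->
  halt_in A t n = true -> halt_in A' t' n = true.
Proof.
  unfold halt_in; rewrite !andb_true_iff, !negb_true_iff, !Nat.eqb_neq.
  intros HA Ht [Hc H]; split; [exact Hc|].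
  destruct (U A t n n) as [|y] eqn:E; [contradiction|].
  rewrite (U_mono _ _ _ _ _ _ _ HA Ht E); discriminate.
Qed.

Lemma jump_spec A n : jump A n = true <-> exists t, halt_in A t n = true.
Proof.
  unfold jump, halt_in.
  destruct (excluded_middle_informative _) as [[p [Hp [y Hy]]]|H].
  - split; auto; intros _. destruct (U_complete _ _ _ _ Hy) as [t Ht].
    exists t. rewrite <- Hp in *; rewrite Ht, andb_true_r. apply is_code_spec; eauto.
  - split; [discriminate|]. intros [t Ht]; exfalso; apply H.
    apply andb_true_iff in Ht as [Hc Ht]. apply is_code_spec in Hc as [p Hp].
    exists p; split; [exact Hp|]. rewrite <- Hp in Ht at 1.
    destruct (U A t (code p) n) as [|y] eqn:E; [discriminate|].
    exists y; exact (U_sound _ _ _ _ _ E).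
Qed.

Lemma jump_halts p A :
  jump A (code p) = true <-> exists t, negb (U A t (code p) (code p) =? 0) = true.
Proof.
  rewrite jump_spec; unfold halt_in.
  assert (is_code (code p) = true) as -> by (apply is_code_spec; eauto). reflexivity.
Qed.

Lemma halts_U p A x : halts p A x <-> exists t, U A t (code p) x <> 0.
Proof.
  split.
  - intros [y Hy]; destruct (U_complete _ _ _ _ Hy) as [t Ht]; exists t; congruence.
  - intros [t Ht]; destruct (U A t (code p) x) as [|y] eqn:E; [contradiction|].
    exists y; exact (U_sound _ _ _ _ _ E).
Qed.

Section CompU.
Context {I : Type} (o : I -> set).

Lemma comp_step (A : I -> nat -> nat -> bool) L s :
  compb2 o A -> comp o L -> comp o s -> comp o (fun i x => step (A i x) (L i x) (s i x)).
Proof.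
  intros HA HL Hs. unfold step, Ev, Rt, push; cbv zeta.
  comps.
Qed.

Lemma comp_U (A : I -> nat -> nat -> bool) t c x :
  compb2 o A -> comp o t -> comp o c -> comp o x ->
  comp o (fun i z => U (A i z) (t i z) (c i z) (x i z)).
Proof.
  intros HA Ht Hc Hx. unfold U.
  assert (Hr : comp o (fun i z => run (A i z) (t i z) (t i z) (Ev (c i z) (x i z) 0))).
  { unfold run. apply (comp_iter o t (fun i z => Ev (c i z) (x i z) 0)
      (fun i z s => step (A i z) (t i z) s)); [assumption| |].
    - unfold Ev; comps.
    - apply (comp_step (fun i z => A i (p1 z)) (fun i z => t i (p1 z)) (fun _ z => p2 z)).
      + apply (compb2_app o A (fun _ z => p1 (p1 z)) (fun _ z => p2 z)); comps.
      + apply comp_app; comps.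
      + comps. }
  unfold out; comps.
Qed.

Lemma compb_is_code n : comp o n -> compb o (fun i x => is_code (n i x)).
Proof.
  intros Hn. unfold is_code, code_table, code_check; cbv zeta.
  comps.
Qed.

Lemma compb_halt_in (A : I -> nat -> nat -> bool) t n :
  compb2 o A -> comp o t -> comp o n ->
  compb o (fun i x => halt_in (A i x) (t i x) (n i x)).
Proof.
  intros. unfold halt_in. apply compb_and; [now apply compb_is_code|].
  apply compb_neg, compb_eqb; [now apply comp_U|comps].
Qed.

End CompU.

Ltac comp_hook ::=
  lazymatch goal with
  | |- comp _ (fun i z => U (@?A i z) (@?t i z) (@?c i z) (@?x i z)) => apply (comp_U _ A t c x)
  | |- compb _ (fun i x => halt_in (@?A i x) (@?t i x) (@?n i x)) => apply (compb_halt_in _ A t n)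
  end.

(** * Jumps *)

Fixpoint konst (n : nat) : prog :=
  match n with 0 => PZero | S n' => PComp PSucc (konst n') end.

Lemma conv_konst n A x : conv (konst n) A x n.
Proof.
  induction n as [|n IH]; [exists 1; reflexivity|].
  eapply conv_comp; [exact IH|exists 1; reflexivity].
Qed.

(* The s-m-n theorem, with [s] independent of the oracle. *)
Lemma Sigma1_jump {I} (o : I -> set) (D : I -> nat -> nat -> bool) : compb2 o D ->
  exists s : nat -> nat,
    (forall J (o' : J -> set) f, comp o' f -> comp o' (fun j x => s (f j x))) /\
    forall i x, jump (o i) (s x) = true <-> exists t, D i x t = true.
Proof.
  intros HD. apply compb_neg in HD as [d Hd].
  (* The program discards its input and feeds [x] to the search, so running it on its own code, as
     the jump demands, still decides the question about [x]. *)
  exists (fun x => code (PComp (PMu d) (konst x))); split.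
  - intros J o' f Hf.
    apply (comp_ext _ (fun j x => pr 6 (pr (code (PMu d))
      (nat_rect (fun _ => nat) (pr 0 0) (fun _ h => pr 6 (pr (pr 1 0) h)) (f j x))))).
    + comps.
    + intros j x; cbn [code]; do 2 f_equal.
      induction (f j x) as [|n IH]; simpl; congruence.
  - intros i x.
    rewrite jump_halts.
    transitivity (halts (PMu d) (o i) x).
    + assert (E : halts (PMu d) (o i) x <->
                  halts (PComp (PMu d) (konst x)) (o i) (code (PComp (PMu d) (konst x)))).
      { split; intros [y Hy]; exists y.
        - eapply conv_comp; [apply conv_konst|exact Hy].
        - destruct Hy as [[|k] Hk]; [discriminate|]. cbn [eval] in Hk.
          destruct (eval k (o i) (konst x) _) as [z|] eqn:Ez; [|discriminate].
          assert (z = x) as -> by (eapply conv_det; [exists k; exact Ez|apply conv_konst]).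
          exists k; exact Hk. }
      rewrite E, halts_U. split; intros [t Ht]; exists t;
        revert Ht; rewrite negb_true_iff, Nat.eqb_neq; auto.
    + apply halts_mu. intros t. generalize (Hd i (pr x t)). now rewrite p1_pr, p2_pr.
Qed.

(** * Basis theorems *)

Definition agree (n : nat) (A B : set) : Prop := forall i, i < n -> A i = B i.

(** Compactness of Cantor space. [ext n A] says that the first [n] bits of [A] extend into every
    level; if both one-bit prolongations died, a member of the later of the two fatal levels would
    give a contradiction. *)
Lemma Koenig (C : nat -> set -> Prop) :
  (forall t, exists n, forall A B, agree n A B -> C t A -> C t B) ->
  (forall t A, C (S t) A -> C t A) -> (forall t, exists A, C t A) ->
  exists A, forall t, C t A.
Proof.
  intros Huse Hdec Hne.
  assert (Hle : forall t t' A, t <= t' -> C t' A -> C t A)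
    by (intros t t' A Ht; induction Ht; auto).
  set (ext n A := forall t, exists B, agree n A B /\ C t B).
  assert (Hext : forall n A, ext n A -> exists A', agree n A A' /\ ext (S n) A').
  { intros n A HA.
    set (put b i := if i =? n then b else A i : bool).
    assert (Hput : forall b, agree n A (put b)).
    { intros b i Hi; unfold put; destruct (Nat.eqb_spec i n); [lia|reflexivity]. }
    apply NNPP; intros Hno.
    assert (H : forall b, exists t, forall B, agree (S n) (put b) B -> ~ C t B).
    { intros b; apply NNPP; intros H; apply Hno; exists (put b); split; [apply Hput|].
      intros t; apply NNPP; intros H'; apply H; exists t; intros B HB HC; eauto. }
    destruct (H true) as [t1 H1], (H false) as [t2 H2].
    destruct (HA (max t1 t2)) as [B [HB HC]].
    assert (HB' : agree (S n) (put (B n)) B).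
    { intros i Hi; unfold put; destruct (Nat.eqb_spec i n) as [->|]; [reflexivity|].
      apply HB; lia. }
    destruct (B n); [apply (H1 B HB')|apply (H2 B HB')];
      (eapply Hle; [|exact HC]; lia). }
  assert (H0 : ext 0 (fun _ => false)).
  { intros t; destruct (Hne t) as [B HB]; exists B; split; [intros i Hi; lia|exact HB]. }
  set (nxt n A := epsilon (inhabits A) (fun A' => agree n A A' /\ ext (S n) A')).
  set (a := nat_rect (fun _ => set) (fun _ => false) nxt).
  assert (Ha : forall n, ext n (a n) /\ agree n (a n) (a (S n))).
  { assert (Hs : forall n, ext n (a n) -> agree n (a n) (a (S n)) /\ ext (S n) (a (S n))).
    { intros n Hn; apply (epsilon_spec (inhabits (a n))
        (fun A' => agree n (a n) A' /\ ext (S n) A')), Hext, Hn. }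
    intros n; assert (Hn : ext n (a n)) by (induction n; [exact H0|apply Hs; assumption]).
    split; [exact Hn|apply Hs, Hn]. }
  assert (Hag : forall n m, n <= m -> agree n (a n) (a m)).
  { intros n m Hm; induction Hm as [|m Hm IH]; [intros i _; reflexivity|].
    intros i Hi; rewrite IH by exact Hi; apply (proj2 (Ha m)); lia. }
  exists (fun i => a (S i) i); intros t.
  destruct (Huse t) as [n Hn]. destruct (proj1 (Ha n) t) as [B [HB HC]].
  apply (Hn B); [|exact HC]. intros i Hi. rewrite <- HB by exact Hi.
  symmetry; apply Hag; lia.
Qed.

Lemma agree_cnum A n : agree n A (bit (cnum A n)).
Proof. intros i Hi; rewrite bit_cnum; now apply Nat.ltb_lt in Hi as ->. Qed.

Theorem low_basis e : (exists A, ~ halts e A 0) ->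
  exists M, ~ halts e M 0 /\ Treducible (jump M) (jump emptyset).
Proof.
  intros [A0 HA0].
  (* [j] lists the indices below [n] allowed to enter the jump. *)
  set (Cl n j A t := (U A t (code e) 0 =? 0) &&
    allb n (fun i => bit j i || negb (halt_in A t i))).
  assert (Cl_spec : forall n j A t, Cl n j A t = true <->
    U A t (code e) 0 = 0 /\ forall i, i < n -> bit j i = false -> halt_in A t i = false).
  { intros n j A t; unfold Cl. rewrite andb_true_iff, Nat.eqb_eq, allb_spec.
    split; intros [H1 H2]; split; auto; intros i Hi.
    - intros Hj; specialize (H2 i Hi); rewrite Hj in H2; now apply negb_true_iff.
    - destruct (bit j i) eqn:Hj; [reflexivity|]. simpl; now rewrite H2. }
  assert (Cl_mono : forall n n' j j' A A' t t', agree t A A' -> n <= n' -> t <= t' ->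
    (forall i, i < n -> bit j i = bit j' i) -> Cl n' j' A' t' = true -> Cl n j A t = true).
  { intros n n' j j' A A' t t' HA Hn Ht Hj. rewrite !Cl_spec; intros [H1 H2]; split.
    - destruct (U A t (code e) 0) as [|y] eqn:E; [reflexivity|].
      rewrite (U_mono _ _ _ _ _ _ _ HA Ht E) in H1; discriminate.
    - intros i Hi Hb. destruct (halt_in A t i) eqn:E; [|reflexivity].
      rewrite <- (halt_in_mono _ _ _ _ _ HA Ht E).
      apply H2; [lia|]. rewrite <- Hj; auto. }
  (* The condition at level [t] reads only [t] bits of the oracle, so by compactness emptiness of
     the class shows at a single level, where all [2 ^ t] strings fail. This is a Sigma^0_1
     event. *)
  destruct (Sigma1_jump (fun _ : unit => emptyset) (fun _ x t =>
    allb (2 ^ t) (fun a => negb (Cl (p1 x) (p2 x) (bit a) t)))) as [s [Hs Hjs]].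
  { unfold Cl; comps. }
  specialize (Hjs tt). cbv beta in Hjs.
  set (jn := nat_rect (fun _ => nat) 0
    (fun n h => if jump emptyset (s (pr (S n) h)) then h + 2 ^ n else h)).
  assert (jn_lt : forall n, jn n < 2 ^ n).
  { induction n as [|n IH]; simpl; [lia|]. fold jn. destruct (jump _ _); lia. }
  assert (jn_bit : forall n m i, n <= m -> i < n -> bit (jn n) i = bit (jn m) i).
  { intros n m i Hm Hi; induction Hm as [|m Hm IH]; [reflexivity|].
    rewrite IH; simpl; fold jn; destruct (jump _ _); [|reflexivity].
    rewrite bit_add_high by apply jn_lt. destruct (Nat.eqb_spec i m); [lia|reflexivity]. }
  assert (jn_top : forall n, bit (jn (S n)) n = jump emptyset (s (pr (S n) (jn n)))).
  { intros n; simpl; fold jn; destruct (jump _ _).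
    - rewrite bit_add_high, Nat.eqb_refl by apply jn_lt; reflexivity.
    - apply (bit_high _ n); [apply jn_lt|lia]. }
  assert (jn_bit' : forall n i, i < n -> bit (jn n) i = bit (jn (S n)) i)
    by (intros; apply jn_bit; lia).
  assert (Hinv : forall n t, exists A, Cl n (jn n) A t = true).
  { induction n as [|n IH]; intros t.
    - exists A0; apply Cl_spec; split; [|lia].
      destruct (U A0 t (code e) 0) eqn:E; [reflexivity|].
      exfalso; apply HA0, halts_U; exists t; congruence.
    - destruct (jump emptyset (s (pr (S n) (jn n)))) eqn:E.
      + destruct (IH t) as [A HA]; exists A; apply Cl_spec in HA as [H1 H2].
        apply Cl_spec; split; [exact H1|]. intros i Hi Hb.
        destruct (Nat.eq_dec i n) as [->|]; [rewrite jn_top in Hb; congruence|].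
        apply H2; [lia|]. rewrite jn_bit'; [exact Hb|lia].
      + assert (Hn : ~ exists t, allb (2 ^ t)
          (fun a => negb (Cl (S n) (jn n) (bit a) t)) = true).
        { intros H. specialize (Hjs (pr (S n) (jn n))). rewrite p1_pr, p2_pr in Hjs.
          apply Hjs in H; congruence. }
        destruct (allb (2 ^ t) (fun a => negb (Cl (S n) (jn n) (bit a) t))) eqn:Ea;
          [exfalso; eauto|].
        apply allb_false in Ea as [a [_ Ha]]. apply negb_false_iff in Ha.
        exists (bit a). simpl; fold jn; rewrite E; exact Ha. }
  destruct (Koenig (fun t A => Cl t (jn t) A t = true)) as [M HM].
  - intros t; exists t; intros A B HAB. apply Cl_mono; auto.
    intros i Hi; symmetry; auto.
  - intros t A; apply Cl_mono; [intros i _; reflexivity|lia|lia|]. intros; apply jn_bit; lia.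
  - intros t; apply Hinv.
  - exists M; split.
    + rewrite halts_U; intros [t Ht]; apply Ht. apply (proj1 (Cl_spec _ _ _ _) (HM t)).
    + assert (HMU : forall t, U M t (code e) 0 = 0)
        by (intros t; apply (proj1 (Cl_spec _ _ _ _) (HM t))).
      assert (HMh : forall n t, bit (jn (S n)) n = false -> halt_in M t n = false).
      { intros n t Hn. destruct (proj1 (Cl_spec _ _ _ _) (HM (max (S n) t))) as [_ H].
        destruct (halt_in M t n) eqn:E; [|reflexivity].
        rewrite <- (H n); [|lia|].
        - symmetry; apply (halt_in_mono M M t); [reflexivity|lia|exact E].
        - rewrite <- Hn; symmetry; apply jn_bit; lia. }
      assert (HJ : forall n, jump M n = bit (jn (S n)) n).
      { intros n. destruct (bit (jn (S n)) n) eqn:E.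
        - rewrite jn_top in E. apply Hjs in E as [t Ht]. rewrite p1_pr, p2_pr, allb_spec in Ht.
          specialize (Ht (cnum M t) (cnum_lt _ _)). apply negb_true_iff in Ht.
          destruct (jump M n) eqn:En; [reflexivity|].
          rewrite <- Ht. apply (Cl_mono _ (S n) _ (jn n) _ M _ t); auto.
          + intros i Hi; symmetry; apply agree_cnum, Hi.
          + apply Cl_spec; split; [apply HMU|]. intros i Hi Hb.
            destruct (Nat.eq_dec i n) as [->|].
            * destruct (halt_in M t n) eqn:Eh; [|reflexivity].
              rewrite <- En; symmetry; apply jump_spec; eauto.
            * apply HMh. rewrite <- Hb; apply jn_bit; lia.
        - destruct (jump M n) eqn:En; [|reflexivity].
          apply jump_spec in En as [t Ht]. rewrite HMh in Ht by exact E. discriminate. }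
      apply Treducible_comp.
      apply (compb_ext _ (fun _ n => bit (jn (S n)) n)); [|intros; symmetry; apply HJ].
      comps. unfold jn. comps.
      apply (compb_oracle (fun _ : unit => jump emptyset)
        (fun _ z => s (pr (S (p1 (p2 z))) (p2 (p2 z))))).
      apply Hs; comps.
Qed.

Theorem PA_rel_member P B (F : set -> nat -> bool) :
  PA_rel P B -> compb (join B) F -> (exists X, forall t, F X t = true) ->
  exists X, (forall t, F X t = true) /\ Treducible X P.
Proof.
  intros HP HF HX.
  (* [halts_mu] detects some [t] at which its predicate holds; here that predicate is the failure of
     [F], whence the double negation. *)
  assert (HF' : compb (join B) (fun X z => negb (negb (F X (p2 z))))).
  { do 2 apply compb_neg. apply compb_app; [exact HF|comps]. }
  destruct HF' as [p Hp].
  assert (He : forall X, in_Pi01 B (PMu p) X <-> forall t, F X t = true).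
  { intros X; unfold in_Pi01. rewrite (halts_mu p (join B X) (fun t => negb (F X t))).
    - split; [|intros H [t Ht]; now rewrite H in Ht].
      intros H t; destruct (F X t) eqn:E; [reflexivity|]. exfalso; apply H; exists t; now rewrite E.
    - intros t; generalize (Hp X (pr 0 t)); now rewrite p2_pr. }
  destruct (HP (PMu p)) as [X [H1 H2]].
  - destruct HX as [X HX]; exists X; now apply He.
  - exists X; split; [now apply He|exact H2].
Qed.

Lemma compb_join_l B : compb (join B) (fun _ x => B x).
Proof.
  apply (compb_ext _ (fun X x => join B X (2 * x))); [apply compb_oracle; comps|].
  intros X x; unfold join. rewrite Nat.div2_double, Nat.even_mul; reflexivity.
Qed.

Lemma compb_join_r B : compb (join B) (fun X x => X x).
Proof.
  apply (compb_ext _ (fun X x => join B X (S (2 * x)))); [apply compb_oracle; comps|].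
  intros X x; unfold join. rewrite Nat.div2_succ_double, Nat.even_succ, Nat.odd_mul; reflexivity.
Qed.

(** The class whose only member is [B] is Pi^0_1 relative to [B]. *)
Lemma PA_rel_reduces P B : PA_rel P B -> Treducible B P.
Proof.
  intros HP.
  destruct (PA_rel_member P B (fun X x => eqb (X x) (B x)) HP) as [X [HX HXP]].
  - apply compb_beq; [apply compb_join_r|apply compb_join_l].
  - exists B; intros; apply eqb_reflx.
  - apply Treducible_comp. apply Treducible_comp in HXP.
    apply (compb_ext _ _ _ HXP). intros _ x; apply eqb_prop, HX.
Qed.

Lemma low_member (F : set -> nat -> bool) : compb (fun X => X) F ->
  (exists X, forall t, F X t = true) ->
  exists X, (forall t, F X t = true) /\ Treducible (jump X) (jump emptyset).
Proof.
  intros HF HX.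
  assert (HF' : compb (fun X : set => X) (fun X z => negb (negb (F X (p2 z))))).
  { do 2 apply compb_neg. apply compb_app; [exact HF|comps]. }
  destruct HF' as [p Hp].
  assert (He : forall X, ~ halts (PMu p) X 0 <-> forall t, F X t = true).
  { intros X. rewrite (halts_mu p X (fun t => negb (F X t))).
    - split; [|intros H [t Ht]; now rewrite H in Ht].
      intros H t; destruct (F X t) eqn:E; [reflexivity|]. exfalso; apply H; exists t; now rewrite E.
    - intros t; generalize (Hp X (pr 0 t)); now rewrite p2_pr. }
  destruct (low_basis (PMu p)) as [X [H1 H2]].
  - destruct HX as [X HX]; exists X; now apply He.
  - exists X; split; [now apply He|exact H2].
Qed.

Lemma jump_above M : Treducible M (jump M).
Proof.
  destruct (Sigma1_jump (fun X : set => X) (fun X x _ => X x)) as [s [Hs Hj]].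
  { apply (compb_oracle (fun X : set => X) (fun _ z => p1 z)); comps. }
  apply Treducible_comp.
  apply (compb_ext _ (fun _ x => jump M (s x))).
  - apply (compb_oracle (fun _ : unit => jump M) (fun _ x => s x)), Hs; comps.
  - intros _ x. specialize (Hj M x). cbv beta in Hj.
    destruct (jump M (s x)), (M x); try reflexivity; exfalso.
    + destruct (proj1 Hj eq_refl); discriminate.
    + discriminate (proj2 Hj (ex_intro _ 0 eq_refl)).
Qed.

Lemma Treducible_trans A B C : Treducible A B -> Treducible B C -> Treducible A C.
Proof.
  rewrite !Treducible_comp; intros HA HB. exact (comp_oracle_trans _ (fun _ => B) _ HA HB).
Qed.

Lemma allb_ext n P Q : (forall j, j < n -> P j = Q j) -> allb n P = allb n Q.
Proof.
  intros H; unfold allb; induction n as [|n IH]; simpl; [reflexivity|].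
  rewrite H, IH by (intros; try apply H; lia). reflexivity.
Qed.

(** * Mathias forcing for the Erdős–Moser theorem *)

Section Forcing.

Context (R : nat -> nat -> nat -> bool).
Hypothesis R_anti : forall e x y, x <> y -> R e y x = negb (R e x y).
Hypothesis R_irr : forall e x, R e x x = false.
Hypothesis R_comp : forall J (o : J -> set) f g h, comp o f -> comp o g -> comp o h ->
  compb o (fun i x => R (f i x) (g i x) (h i x)).

(* A state codes the time, the finite approximation to the generic, the current question, the
   mode (0, or the successor of the state in which the question got a positive answer) and the
   list of reservoir constraints.  The constraint [<u, v>] added at time [x] requires of [y] that
   [R e x y] be the [e]-th digit of [u] for all [e < x] and, if [v = 1 + <k, c>], that [y] be
   given the colour [c] by the colouring [M<k, .>]. *)
Definition sT s := p1 s.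
Definition sF s := p1 (p2 s).
Definition sq s := p1 (p2 (p2 s)).
Definition sm s := p1 (p2 (p2 (p2 s))).
Definition sL s := p2 (p2 (p2 (p2 s))).
Definition mk t F q m L := pr t (pr F (pr q (pr m L))).

(** The list is a left-nested chain of pairs with the newest entry outermost, so the entry made at
    time [x] lies beneath [t - 1 - x] newer ones. *)
Definition entry (L t x : nat) : nat := p2 (Nat.iter (t - 1 - x) p1 L).

Definition chk (M : set) (x en y : nat) : bool :=
  allb x (fun e => eqb (R e x y) (bit (p1 en) e)) &&
  ((p2 en =? 0) ||
   allb x (fun e => eqb (M (pr (p1 (pred (p2 en))) (pr e y))) (bit (p2 (pred (p2 en))) e))).

(** The bound [sT s <= y] keeps the reservoir above the finite part and above every [e < sT s]. An
    element chosen from it later therefore has a recorded direction for each of these [e]. *)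
Definition resv (M : set) (s y : nat) : bool :=
  (sT s <=? y) && allb (sT s) (fun x => chk M x (entry (sL s) (sT s) x) y).

Definition cyc e x y z := R e x y && R e y z && R e z x.

Definition acyc (e l E : nat) : bool :=
  allb l (fun x => allb l (fun y => allb l (fun z =>
    negb (bit E x && bit E y && bit E z && cyc e x y z)))).

Definition hom (c : set) (e l E : nat) : bool :=
  allb l (fun x => allb l (fun y =>
    negb (bit E x && bit E y) || eqb (c (pr e x)) (c (pr e y)))).

(** The colour of [y] is the vector of bits [c (pr e y)] with [e < sT s], and homogeneity is
    required in every coordinate. *)
Definition Ext (M : set) (s l : nat) (c : set) (E : nat) : bool :=
  allb l (fun y => negb (bit E y) || resv M s y) &&
  allb (sT s) (fun e => hom c e l E && acyc e l E) &&
  halt_in (fun y => bit (sF s) y || bit E y) l (sq s).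

(* The forcing question at [s] is answered positively when some level has no good colouring. *)
Definition Good (M : set) (s l : nat) (c : set) : bool :=
  allb (2 ^ l) (fun E => negb (Ext M s l c E)).

(** By [pr_le_square] this exceeds all positions [pr e y] with [e < sT s] and [y < l], the only ones
    that [Good] at level [l] reads. Hence a colouring may be replaced by a number below
    [2 ^ bnd s l], and solvability is decidable from [M]. *)
Definition bnd (s l : nat) : nat := (sT s + l) * (sT s + l).

Definition solvable (M : set) (s l : nat) : bool :=
  exb (2 ^ bnd s l) (fun a => Good M s l (bit a)).

(** Decidable from [M] for each [s] and [l], so demanding it everywhere defines a Pi^0_1 class.
    Being an implication, it can be satisfied whatever the answer at [s] is. *)
Definition solves (M : set) (s l : nat) : bool :=
  negb (solvable M s l) || Good M s l (fun i => M (pr s i)).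

(** The guessed limit colouring: by [pattern_st] and [resv_R], for [e < x < t] its bit at [pr e x]
    is the common value of [R e x y] over all [y] in the reservoir at time [t]. *)
Definition pattern (L t : nat) : set := fun i => bit (p1 (entry L t (p2 i))) (p1 i).

(* The guesses made at one time: [r 0] is the answer to the question, the digits [r (1 + 2 * e)]
   the pattern and the digits [r (2 + 2 * e)] the colour. *)
Definition advance (M : set) (r : nat -> bool) (s : nat) : nat :=
  let t := sT s in
  let u := cnum (fun e => r (1 + 2 * e)) t in
  if sm s =? 0 then
    if r 0 then mk (S t) (sF s) (sq s) (S s) (pr (sL s) (pr u 0))
    else mk (S t) (sF s) (S (sq s)) 0 (pr (sL s) (pr u (S (pr s (cnum (fun e => r (2 + 2 * e)) t)))))
  else
    if exb (2 ^ t) (Ext M (pred (sm s)) t (pattern (sL s) t)) then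
      mk (S t)
        (cnum (fun y => bit (sF s) y ||
                 bit (leastb (2 ^ t) (Ext M (pred (sm s)) t (pattern (sL s) t))) y) t)
        (S (sq s)) 0 (pr (sL s) (pr u 0))
    else mk (S t) (sF s) (sq s) (sm s) (pr (sL s) (pr u 0)).

Definition st (M W : set) (t : nat) : nat :=
  nat_rect (fun _ => nat) (mk 0 0 0 0 0) (fun t s => advance M (fun i => W (pr t i)) s) t.

Section CompForcing.
Context {J : Type} (o : J -> set) (M : J -> set).
Hypothesis M_comp : compb o (fun i x => M i x).

Ltac hook_M :=
  idtac; lazymatch goal with
  | |- compb _ (fun i x => R (@?f i x) (@?g i x) (@?h i x)) => apply (R_comp J o f g h)
  | |- compb _ (fun i x => M i (@?f i x)) => apply (compb_app o (fun i x => M i x) f M_comp)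
  end.

Lemma compb_resv s y : comp o s -> comp o y ->
  compb o (fun i z => resv (M i) (s i z) (y i z)).
Proof. intros; unfold resv, chk, entry, sT, sL; comps_with hook_M. Qed.

Ltac hook_resv :=
  idtac; lazymatch goal with
  | |- compb _ (fun i z => resv (M i) (@?s i z) (@?y i z)) => apply (compb_resv s y)
  | |- _ => hook_M
  end.

Lemma compb_Ext s l (c : J -> nat -> nat -> bool) E :
  comp o s -> comp o l -> compb2 o c -> comp o E ->
  compb o (fun i z => Ext (M i) (s i z) (l i z) (c i z) (E i z)).
Proof. intros; unfold Ext, hom, acyc, cyc, sT, sF, sq; comps_with hook_resv. Qed.

Ltac hook_Ext :=
  idtac; lazymatch goal with
  | |- compb _ (fun i z => Ext (M i) (@?s i z) (@?l i z) (@?c i z) (@?E i z)) =>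
      apply (compb_Ext s l c E)
  | |- _ => hook_resv
  end.

Lemma compb_Good s l (c : J -> nat -> nat -> bool) :
  comp o s -> comp o l -> compb2 o c ->
  compb o (fun i z => Good (M i) (s i z) (l i z) (c i z)).
Proof. intros; unfold Good; comps_with hook_Ext. Qed.

Ltac hook_Good :=
  idtac; lazymatch goal with
  | |- compb _ (fun i z => Good (M i) (@?s i z) (@?l i z) (@?c i z)) => apply (compb_Good s l c)
  | |- _ => hook_Ext
  end.

Lemma compb_solvable s l : comp o s -> comp o l ->
  compb o (fun i z => solvable (M i) (s i z) (l i z)).
Proof. intros; unfold solvable, bnd, sT; comps_with hook_Good. Qed.

Lemma compb_solves s l : comp o s -> comp o l ->
  compb o (fun i z => solves (M i) (s i z) (l i z)).
Proof.
  intros; unfold solves. apply compb_or; [now apply compb_neg, compb_solvable|comps_with hook_Good].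
Qed.

Lemma comp_advance (r : J -> nat -> nat -> bool) s : compb2 o r -> comp o s ->
  comp o (fun i z => advance (M i) (r i z) (s i z)).
Proof.
  intros; unfold advance, mk, pattern, entry, sT, sF, sq, sm, sL; cbv zeta; comps_with hook_Ext.
Qed.

Lemma comp_st (W : J -> nat -> bool) t : compb o W -> comp o t ->
  comp o (fun i z => st (M i) (W i) (t i z)).
Proof.
  intros; unfold st, mk. apply comp_rec; [comps|comps|].
  apply (comp_advance (fun i z => (fun j => W i (pr (p1 (p2 z)) j))) (fun _ z => p2 (p2 z))); comps.
Qed.

End CompForcing.

(** ** Existence of a suitable family of colourings *)

Lemma iter_p1_le n L : Nat.iter n p1 L <= L.
Proof.
  induction n as [|n IH]; simpl; [lia|].
  pose proof (p1_le (Nat.iter n p1 L)); lia.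
Qed.

Lemma entry_le s x : entry (sL s) (sT s) x <= s.
Proof.
  unfold entry, sL.
  pose proof (p2_le (Nat.iter (sT s - 1 - x) p1 (p2 (p2 (p2 (p2 s)))))).
  pose proof (iter_p1_le (sT s - 1 - x) (p2 (p2 (p2 (p2 s))))).
  pose proof (p2_le s). pose proof (p2_le (p2 s)). pose proof (p2_le (p2 (p2 s))).
  pose proof (p2_le (p2 (p2 (p2 s)))). lia.
Qed.

(** The index of a colouring in a constraint is extracted from the number [s] and, owing to the
    successor in its encoding, is strictly smaller than [s]. *)
Lemma resv_local M M' s y : (forall k i, k < s -> M (pr k i) = M' (pr k i)) ->
  resv M s y = resv M' s y.
Proof.
  intros H; unfold resv; f_equal; apply allb_ext; intros x _; unfold chk; f_equal.
  destruct (Nat.eqb_spec (p2 (entry (sL s) (sT s) x)) 0); [reflexivity|]; simpl.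
  apply allb_ext; intros e _; f_equal; apply H.
  pose proof (entry_le s x). pose proof (p2_le (entry (sL s) (sT s) x)).
  pose proof (p1_le (pred (p2 (entry (sL s) (sT s) x)))). lia.
Qed.

Lemma Ext_local M M' s l c c' E : (forall k i, k < s -> M (pr k i) = M' (pr k i)) ->
  (forall e y, e < sT s -> y < l -> bit E y = true -> resv M s y = true ->
     c (pr e y) = c' (pr e y)) ->
  Ext M s l c E = true -> Ext M' s l c' E = true.
Proof.
  unfold Ext. rewrite !andb_true_iff, !allb_spec. intros HM Hc [[H1 H2] H3].
  repeat split; [| |exact H3].
  - intros y Hy; rewrite <- (resv_local M M'); auto.
  - intros e He; specialize (H2 e He); rewrite andb_true_iff in *.
    destruct H2 as [H2 H4]; split; [|exact H4].
    unfold hom in *. rewrite allb_spec in *; intros x Hx; specialize (H2 x Hx).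
    rewrite allb_spec in *; intros y Hy; specialize (H2 y Hy).
    destruct (bit E x) eqn:Ex, (bit E y) eqn:Ey; try reflexivity. simpl in *.
    rewrite <- !Hc; auto.
    + generalize (H1 y Hy); now rewrite Ey.
    + generalize (H1 x Hx); now rewrite Ex.
Qed.

Lemma Good_local M M' s l c c' : (forall k i, k < s -> M (pr k i) = M' (pr k i)) ->
  (forall e y, e < sT s -> y < l -> c (pr e y) = c' (pr e y)) ->
  Good M s l c = true -> Good M' s l c' = true.
Proof.
  unfold Good; rewrite !allb_spec; intros HM Hc H E HE; specialize (H E HE).
  rewrite negb_true_iff in *. destruct (Ext M' s l c' E) eqn:EE; [|reflexivity].
  rewrite <- H; symmetry; apply (Ext_local M' M s l c' c); [| |exact EE].
  - intros; symmetry; auto.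
  - intros; symmetry; auto.
Qed.

Lemma Ext_mono M s l l' c E : l <= l' -> E < 2 ^ l ->
  Ext M s l c E = true -> Ext M s l' c E = true.
Proof.
  unfold Ext. rewrite !andb_true_iff, !allb_spec. intros Hl HE [[H1 H2] H3].
  assert (Hb : forall y, bit E y = true -> y < l).
  { intros y Hy; destruct (Nat.lt_ge_cases y l); [assumption|].
    rewrite (bit_high _ l) in Hy by assumption; discriminate. }
  repeat split.
  - intros y _; destruct (bit E y) eqn:Ey; [|reflexivity].
    specialize (H1 y (Hb y Ey)); rewrite Ey in H1; exact H1.
  - intros e He; specialize (H2 e He); rewrite andb_true_iff in *. destruct H2 as [H2 H4].
    unfold hom, acyc in *; split.
    + rewrite allb_spec in *; intros x _; rewrite allb_spec; intros y _.
      destruct (bit E x) eqn:Ex, (bit E y) eqn:Ey; try reflexivity.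
      specialize (H2 x (Hb x Ex)). rewrite allb_spec in H2; specialize (H2 y (Hb y Ey)).
      rewrite Ex, Ey in H2; exact H2.
    + rewrite allb_spec in *; intros x _; rewrite allb_spec; intros y _; rewrite allb_spec; intros z _.
      destruct (bit E x) eqn:Ex, (bit E y) eqn:Ey, (bit E z) eqn:Ez; try reflexivity.
      specialize (H4 x (Hb x Ex)). rewrite allb_spec in H4; specialize (H4 y (Hb y Ey)).
      rewrite allb_spec in H4; specialize (H4 z (Hb z Ez)).
      rewrite Ex, Ey, Ez in H4; exact H4.
  - exact (halt_in_mono _ _ l l' _ (fun _ _ => eq_refl) Hl H3).
Qed.

Lemma Good_mono M s l l' c : l <= l' -> Good M s l' c = true -> Good M s l c = true.
Proof.
  unfold Good; rewrite !allb_spec; intros Hl H E HE. rewrite negb_true_iff.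
  destruct (Ext M s l c E) eqn:EE; [|reflexivity].
  apply (Ext_mono M s l l' c E Hl HE) in EE.
  assert (HN : negb (Ext M s l' c E) = true)
    by (apply H; pose proof (Nat.pow_le_mono_r 2 l l'); lia).
  rewrite EE in HN; discriminate.
Qed.

Lemma solvable_spec M s l :
  solvable M s l = true <-> exists c, Good M s l c = true.
Proof.
  unfold solvable; rewrite exb_spec; split.
  - intros [a [_ Ha]]; eauto.
  - intros [c Hc]; exists (cnum c (bnd s l)); split; [apply cnum_lt|].
    apply (Good_local M M s l c); [reflexivity| |exact Hc].
    intros e y He Hy; apply agree_cnum. unfold bnd.
    pose proof (pr_le_square e y); nia.
Qed.

(** Solvability passes to lower levels. If it fails somewhere, a good colouring at the last solvable
    level, if there is one, serves all of them; otherwise compactness applies. *)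
Lemma solution_exists M s :
  exists c, forall l, solvable M s l = true -> Good M s l c = true.
Proof.
  assert (Hn : forall n, solvable M s n = false ->
    exists c, forall l, solvable M s l = true -> Good M s l c = true).
  { assert (Hm : forall l l', solvable M s l = true -> l' <= l -> solvable M s l' = true).
    { intros l l'; rewrite !solvable_spec; intros [c Hc] Hl; exists c.
      apply (Good_mono M s l' l); auto. }
    induction n as [|n IH]; intros H.
    - exists (fun _ => false); intros l Hl. rewrite (Hm l 0) in H; [discriminate|auto|lia].
    - destruct (solvable M s n) eqn:E; [|auto].
      apply solvable_spec in E as [c Hc]; exists c; intros l Hl.
      apply (Good_mono M s l n); [|exact Hc].
      destruct (Nat.le_gt_cases l n); [assumption|].
      rewrite (Hm l (S n)) in H; [discriminate|auto|lia]. }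
  destruct (classic (exists n, solvable M s n = false)) as [[n H]|H]; [eauto|].
  destruct (Koenig (fun l c => Good M s l c = true)) as [c Hc].
  - intros l; exists (bnd s l); intros A B HAB. apply Good_local; [reflexivity|].
    intros e y He Hy; apply HAB. unfold bnd. pose proof (pr_le_square e y); nia.
  - intros l c; apply Good_mono; lia.
  - intros l; apply solvable_spec. destruct (solvable M s l) eqn:E; [reflexivity|].
    exfalso; eauto.
  - exists c; auto.
Qed.

(** The problem for column [s] depends only on the columns below [s], so the columns are chosen by
    recursion. [tab n] is the table after [n] choices; an entry once made never changes. *)
Lemma solving_family_exists : exists M, forall s l, solves M s l = true.
Proof.
  set (flat (T : nat -> set) := fun n => T (p1 n) (p2 n)).
  set (pick (T : nat -> set) s := epsilon (inhabits (fun _ : nat => false))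
    (fun c => forall l, solvable (flat T) s l = true -> Good (flat T) s l c = true)).
  set (tab := nat_rect (fun _ => nat -> set) (fun _ _ => false)
    (fun s T k => if k =? s then pick T s else T k)).
  assert (Hst : forall n k, k < n -> tab n k = tab (S k) k).
  { intros n k Hk; induction Hk as [|n Hk IH]; [reflexivity|].
    rewrite <- IH; simpl; fold tab. destruct (Nat.eqb_spec k n); [lia|reflexivity]. }
  set (M := fun n => tab (S (p1 n)) (p1 n) (p2 n)).
  exists M; intros s l. unfold solves.
  assert (HM : forall k i, k < s -> flat (tab s) (pr k i) = M (pr k i)).
  { intros k i Hk; unfold flat, M. rewrite p1_pr, p2_pr, Hst by exact Hk; reflexivity. }
  destruct (solvable M s l) eqn:E; [|reflexivity]; simpl.
  apply (Good_local (flat (tab s)) M s l (pick (tab s) s)); [exact HM| |].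
  - intros e y _ _; unfold M; rewrite p1_pr, p2_pr; simpl; fold tab; now rewrite Nat.eqb_refl.
  - apply (epsilon_spec (inhabits (fun _ : nat => false))
      (fun c => forall l, solvable (flat (tab s)) s l = true -> Good (flat (tab s)) s l c = true)).
    + apply solution_exists.
    + apply solvable_spec in E as [c Hc]; apply solvable_spec; exists c.
      apply (Good_local M (flat (tab s)) s l c); [|reflexivity|exact Hc].
      intros; symmetry; auto.
Qed.

(** ** Runs of the construction *)

Lemma sT_mk t F q m L : sT (mk t F q m L) = t.
Proof. apply p1_pr. Qed.
Lemma sF_mk t F q m L : sF (mk t F q m L) = F.
Proof. unfold sF, mk; now rewrite p2_pr, p1_pr. Qed.
Lemma sq_mk t F q m L : sq (mk t F q m L) = q.
Proof. unfold sq, mk; now rewrite !p2_pr, p1_pr. Qed.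
Lemma sm_mk t F q m L : sm (mk t F q m L) = m.
Proof. unfold sm, mk; now rewrite !p2_pr, p1_pr. Qed.
Lemma sL_mk t F q m L : sL (mk t F q m L) = L.
Proof. unfold sL, mk; now rewrite !p2_pr. Qed.

Ltac proj := rewrite ?sT_mk, ?sF_mk, ?sq_mk, ?sm_mk, ?sL_mk.

Lemma sT_advance M r s : sT (advance M r s) = S (sT s).
Proof.
  unfold advance; cbv zeta.
  destruct (sm s =? 0); [destruct (r 0)|destruct (exb _ _)]; now proj.
Qed.

Lemma sL_advance M r s : exists v,
  sL (advance M r s) = pr (sL s) (pr (cnum (fun e => r (1 + 2 * e)) (sT s)) v).
Proof.
  unfold advance; cbv zeta.
  destruct (sm s =? 0); [destruct (r 0)|destruct (exb _ _)]; proj; eexists; reflexivity.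
Qed.

Lemma entry_advance_old M r s x : x < sT s ->
  entry (sL (advance M r s)) (S (sT s)) x = entry (sL s) (sT s) x.
Proof.
  intros Hx. destruct (sL_advance M r s) as [v ->]. unfold entry.
  replace (S (sT s) - 1 - x) with (S (sT s - 1 - x)) by lia.
  now rewrite Nat.iter_succ_r, p1_pr.
Qed.

Lemma entry_advance_new M r s :
  entry (sL (advance M r s)) (S (sT s)) (sT s) = p2 (sL (advance M r s)).
Proof. unfold entry. now replace (S (sT s) - 1 - sT s) with 0 by lia. Qed.

Lemma resv_advance M r s y : resv M (advance M r s) y = true <->
  resv M s y = true /\ sT s < y /\ chk M (sT s) (p2 (sL (advance M r s))) y = true.
Proof.
  unfold resv; rewrite sT_advance, !andb_true_iff, !allb_spec, !Nat.leb_le.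
  split.
  - intros [Hy H]. split; [split; [lia|]|split; [lia|]].
    + intros x Hx; rewrite <- (entry_advance_old M r) by exact Hx; apply H; lia.
    + rewrite <- entry_advance_new; apply H; lia.
  - intros [[_ H] [Hy H']]; split; [lia|]. intros x Hx.
    destruct (Nat.eq_dec x (sT s)) as [->|].
    + now rewrite entry_advance_new.
    + rewrite entry_advance_old by lia; apply H; lia.
Qed.

Lemma cyc_rot e x y z : cyc e x y z = cyc e y z x.
Proof. unfold cyc; destruct (R e x y), (R e y z), (R e z x); reflexivity. Qed.

Section Run.
Context (M W : set).
Hypothesis M_solves : forall s l, solves M s l = true.
Local Notation s_ t := (st M W t).
Local Notation row t := (fun i => W (pr t i)).

Lemma st_S t : s_ (S t) = advance M (row t) (s_ t).
Proof. reflexivity. Qed.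

Lemma sT_st t : sT (s_ t) = t.
Proof. induction t; [apply sT_mk|]. now rewrite st_S, sT_advance, IHt. Qed.

Lemma resv_ge t y : resv M (s_ t) y = true -> t <= y.
Proof. unfold resv; rewrite sT_st, andb_true_iff, Nat.leb_le; tauto. Qed.

Lemma resv_le t t' y : t <= t' -> resv M (s_ t') y = true -> resv M (s_ t) y = true.
Proof.
  intros Ht; induction Ht as [|t' Ht IH]; [auto|].
  rewrite st_S, resv_advance; tauto.
Qed.

Lemma pattern_st t e x : e < x -> x < t -> pattern (sL (s_ t)) t (pr e x) = W (pr x (1 + 2 * e)).
Proof.
  intros He; unfold pattern; rewrite p1_pr, p2_pr.
  induction t as [|t IH]; intros Hx; [lia|].
  destruct (Nat.eq_dec x t) as [->|].
  - pose proof (entry_advance_new M (row t) (s_ t)) as H; rewrite sT_st, <- st_S in H.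
    rewrite H, st_S. destruct (sL_advance M (row t) (s_ t)) as [v ->].
    rewrite p2_pr, p1_pr, bit_cnum, sT_st.
    destruct (Nat.ltb_spec e t); [reflexivity|lia].
  - pose proof (entry_advance_old M (row t) (s_ t) x) as H; rewrite sT_st, <- st_S in H.
    rewrite H by lia. apply IH; lia.
Qed.

Lemma resv_R t e x y : resv M (s_ t) y = true -> e < x -> x < t -> R e x y = W (pr x (1 + 2 * e)).
Proof.
  intros H He Hx. apply (resv_le (S x)) in H; [|lia].
  rewrite st_S, resv_advance in H. destruct H as [_ [_ H]].
  unfold chk in H; rewrite sT_st, andb_true_iff, allb_spec in H. destruct H as [H _].
  specialize (H e He). apply eqb_prop in H; rewrite H.
  destruct (sL_advance M (row x) (s_ x)) as [v ->].
  rewrite p2_pr, p1_pr, bit_cnum, sT_st.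
  destruct (Nat.ltb_spec e x); [reflexivity|lia].
Qed.

Lemma st_yes t : sm (s_ t) = 0 -> W (pr t 0) = true ->
  sF (s_ (S t)) = sF (s_ t) /\ sq (s_ (S t)) = sq (s_ t) /\ sm (s_ (S t)) = S (s_ t).
Proof.
  intros Hm Hw. rewrite st_S; unfold advance; cbv zeta.
  rewrite Hm, Hw; cbn [Nat.eqb]; proj; auto.
Qed.

Lemma st_no t : sm (s_ t) = 0 -> W (pr t 0) = false ->
  sF (s_ (S t)) = sF (s_ t) /\ sq (s_ (S t)) = S (sq (s_ t)) /\ sm (s_ (S t)) = 0 /\
  exists v, p2 (p2 (sL (s_ (S t)))) = S (pr (s_ t) v).
Proof.
  intros Hm Hw. rewrite st_S; unfold advance; cbv zeta.
  rewrite Hm, Hw; cbn [Nat.eqb]; proj; repeat split; auto.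
  eexists; rewrite !p2_pr; reflexivity.
Qed.

Lemma st_search t : sm (s_ t) <> 0 ->
  (exists E, E < 2 ^ t /\ Ext M (pred (sm (s_ t))) t (pattern (sL (s_ t)) t) E = true /\
     sm (s_ (S t)) = 0 /\ sq (s_ (S t)) = S (sq (s_ t)) /\
     forall y, bit (sF (s_ (S t))) y = (y <? t) && (bit (sF (s_ t)) y || bit E y)) \/
  (Good M (pred (sm (s_ t))) t (pattern (sL (s_ t)) t) = true /\
     sF (s_ (S t)) = sF (s_ t) /\ sq (s_ (S t)) = sq (s_ t) /\ sm (s_ (S t)) = sm (s_ t)).
Proof.
  intros Hm. rewrite st_S; unfold advance; cbv zeta. rewrite sT_st.
  destruct (Nat.eqb_spec (sm (s_ t)) 0) as [|_]; [contradiction|].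
  destruct (exb (2 ^ t) (Ext M (pred (sm (s_ t))) t (pattern (sL (s_ t)) t))) eqn:E; proj.
  - left. apply exb_spec, leastb_spec in E. destruct E as [H1 H2].
    eexists; split; [exact H1|]. repeat split; [exact H2|]. intros y; apply bit_cnum.
  - right. repeat split. rewrite exb_false in E. unfold Good. rewrite allb_spec.
    intros j Hj; now rewrite E.
Qed.

(** The mode stores a state as a mere number; this recovers the time of the run at which that state
    occurred, so that facts about the run apply to the pending question. *)
Lemma search_origin t : sm (s_ t) <> 0 -> exists t0, t0 < t /\
  sm (s_ t) = S (s_ t0) /\ sm (s_ t0) = 0 /\ sF (s_ t) = sF (s_ t0) /\
  forall u, t0 < u <= t -> sm (s_ u) <> 0.
Proof.
  induction t as [|t IH]; intros Hm; [exfalso; apply Hm, sm_mk|].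
  destruct (Nat.eq_dec (sm (s_ t)) 0) as [H0|H0].
  - exists t. destruct (W (pr t 0)) eqn:Hw.
    + destruct (st_yes t H0 Hw) as [H1 [_ H2]]. repeat split; auto.
      intros u Hu; now replace u with (S t) by lia.
    + exfalso; apply Hm, st_no; auto.
  - destruct (st_search t H0) as [[E [_ [_ [H _]]]]|[_ [HF [_ HS]]]]; [contradiction|].
    destruct (IH H0) as [t0 [H1 [H2 [H3 [H4 H5]]]]].
    exists t0; repeat split; [lia|congruence|auto|congruence|].
    intros u Hu; destruct (Nat.eq_dec u (S t)) as [->|]; [auto|apply H5; lia].
Qed.

Lemma sF_S t y : bit (sF (s_ t)) y = true -> y < t /\ bit (sF (s_ (S t))) y = true.
Proof.
  assert (Hlt : forall t y, bit (sF (s_ t)) y = true -> y < t).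
  { clear t y; induction t as [|t IH]; intros y H.
    - simpl in H; rewrite sF_mk in H; unfold bit in H; now rewrite Nat.bits_0 in H.
    - destruct (Nat.eq_dec (sm (s_ t)) 0) as [H0|H0].
      + destruct (W (pr t 0)) eqn:Hw;
          [rewrite (proj1 (st_yes t H0 Hw)) in H|rewrite (proj1 (st_no t H0 Hw)) in H];
          apply IH in H; lia.
      + destruct (st_search t H0) as [[E [_ [_ [_ [_ HE]]]]]|[_ [HF _]]].
        * rewrite HE, andb_true_iff, Nat.ltb_lt in H; lia.
        * rewrite HF in H; apply IH in H; lia. }
  intros H; split; [auto|].
  destruct (Nat.eq_dec (sm (s_ t)) 0) as [H0|H0].
  - destruct (W (pr t 0)) eqn:Hw;
      [rewrite (proj1 (st_yes t H0 Hw))|rewrite (proj1 (st_no t H0 Hw))]; exact H.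
  - destruct (st_search t H0) as [[E [_ [_ [_ [_ HE]]]]]|[_ [HF _]]].
    + rewrite HE, H; apply Hlt, Nat.ltb_lt in H as ->; reflexivity.
    + now rewrite HF.
Qed.

Lemma sF_lt t y : bit (sF (s_ t)) y = true -> y < t.
Proof. intros H; apply sF_S in H; tauto. Qed.

Lemma sF_le t t' y : t <= t' -> bit (sF (s_ t)) y = true -> bit (sF (s_ t')) y = true.
Proof. intros Ht H; induction Ht; [exact H|apply sF_S, IHHt]. Qed.

Lemma Ext_resv s l c E y : Ext M s l c E = true -> y < l -> bit E y = true -> resv M s y = true.
Proof.
  unfold Ext; rewrite !andb_true_iff, !allb_spec. intros [[H _] _] Hy HE.
  specialize (H y Hy); now rewrite HE in H.
Qed.

(** Whatever is added comes from the reservoir of a question asked at some [t0]. Mode 0 at time [t]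
    excludes [t0 < t], so that reservoir is contained in the one at [t]. *)
Lemma new_in_resv t t' y : sm (s_ t) = 0 -> t <= t' -> bit (sF (s_ t')) y = true ->
  bit (sF (s_ t)) y = true \/ resv M (s_ t) y = true.
Proof.
  intros Hm Ht; induction Ht as [|t' Ht IH]; [auto|]. intros H.
  destruct (Nat.eq_dec (sm (s_ t')) 0) as [H0|H0].
  - apply IH. destruct (W (pr t' 0)) eqn:Hw;
      [rewrite (proj1 (st_yes t' H0 Hw)) in H|rewrite (proj1 (st_no t' H0 Hw)) in H]; exact H.
  - destruct (st_search t' H0) as [[E [_ [HX [_ [_ HE]]]]]|[_ [HF _]]].
    + rewrite HE, andb_true_iff, orb_true_iff, Nat.ltb_lt in H.
      destruct H as [Hy [H|H]]; [auto|]. right.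
      destruct (search_origin t' H0) as [t0 [H1 [H2 [H3 [_ H4]]]]].
      rewrite H2 in HX; simpl in HX. apply (Ext_resv _ _ _ _ y) in HX; auto.
      apply (resv_le t t0); [|exact HX].
      destruct (Nat.le_gt_cases t t0); [assumption|]. exfalso; apply (H4 t); auto.
    + apply IH; now rewrite <- HF.
Qed.

(** The case of [c] in the reservoir strengthens the induction: a reservoir element may be chosen
    later, so it must already form no cycle with two chosen ones. In the step where a set [E] is
    added, elements are sorted into those chosen before the question, those of [E], and those still
    in the reservoir. *)
Lemma new_acyclic e t t' : sm (s_ t) = 0 -> e < t -> t <= t' -> forall a b c,
  bit (sF (s_ t')) a = true -> bit (sF (s_ t)) a = false ->
  bit (sF (s_ t')) b = true -> bit (sF (s_ t)) b = false ->
  (bit (sF (s_ t')) c = true /\ bit (sF (s_ t)) c = false) \/ resv M (s_ t') c = true ->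
  cyc e a b c = false.
Proof.
  intros Hm He. induction t' as [t' IH] using lt_wf_ind; intros Ht a b c Ha Ha' Hb Hb' Hc.
  destruct (Nat.eq_dec t t') as [->|]; [congruence|].
  destruct t' as [|u]; [lia|].
  assert (Hsame : sF (s_ (S u)) = sF (s_ u) -> cyc e a b c = false).
  { intros HF; rewrite HF in *. apply (IH u); auto; try lia.
    destruct Hc; auto. right; apply (resv_le u (S u)); auto. }
  destruct (Nat.eq_dec (sm (s_ u)) 0) as [H0|H0].
  { apply Hsame; destruct (W (pr u 0)) eqn:Hw; [now apply st_yes|now apply st_no]. }
  destruct (st_search u H0) as [[E [_ [HX [_ [_ HE]]]]]|[_ [HF _]]]; [|auto].
  clear Hsame.
  destruct (search_origin u H0) as [t0 [H1 [H2 [H3 [HF H4]]]]].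
  rewrite H2 in HX; simpl in HX.
  assert (Ht0 : t <= t0).
  { destruct (Nat.le_gt_cases t t0); [assumption|]. exfalso; apply (H4 t); [lia|exact Hm]. }
  set (old x := bit (sF (s_ t0)) x = true /\ bit (sF (s_ t)) x = false).
  set (new x := bit E x = true /\ x < u).
  assert (Hnew : forall x, new x -> resv M (s_ t0) x = true)
    by (intros x [Hx Hx']; exact (Ext_resv _ _ _ _ _ HX Hx' Hx)).
  assert (Hsplit : forall x, bit (sF (s_ (S u))) x = true -> bit (sF (s_ t)) x = false ->
    old x \/ new x).
  { intros x Hx Hx'; rewrite HE, andb_true_iff, orb_true_iff, Nat.ltb_lt, HF in Hx.
    unfold old, new; tauto. }
  assert (Hold : forall x y z, old x -> old y -> old z \/ resv M (s_ t0) z = true ->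
    cyc e x y z = false).
  { intros x y z [Hx Hx'] [Hy Hy'] Hz; apply (IH t0); auto; lia. }
  (* All elements of a reservoir are on the same side of an element chosen earlier. *)
  assert (Hside : forall x y z, old x -> resv M (s_ t0) y = true -> resv M (s_ t0) z = true ->
    cyc e x y z = false).
  { intros x y z [Hx Hx'] Hy Hz. unfold cyc.
    assert (Hxt : x < t0) by (apply sF_lt; exact Hx).
    assert (Hxe : e < x).
    { destruct (new_in_resv t t0 x Hm Ht0 Hx) as [H|H]; [congruence|].
      apply resv_ge in H; lia. }
    pose proof (resv_ge _ _ Hz).
    rewrite (R_anti e x z), (resv_R t0 e x y), (resv_R t0 e x z) by (auto; lia).
    destruct (W (pr x (1 + 2 * e))), (R e y z); reflexivity. }
  unfold Ext in HX; rewrite !andb_true_iff, !allb_spec in HX. destruct HX as [[_ HX] _].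
  rewrite sT_st in HX. specialize (HX e). rewrite andb_true_iff in HX.
  destruct HX as [Hhom Hacyc]; [lia|].
  (* [E] is homogeneous for the guessed limit colouring, so [x] and [y] stand in the same direction
     to every [z] of the thinned reservoir, and no cycle passes through all three. *)
  assert (Hnnr : forall x y z, new x -> new y -> resv M (s_ (S u)) z = true ->
    cyc e x y z = false).
  { intros x y z Hx Hy Hz. unfold cyc.
    pose proof (resv_ge _ _ Hz). pose proof (resv_ge _ _ (Hnew x Hx)).
    pose proof (resv_ge _ _ (Hnew y Hy)). destruct Hx as [Hx Hxu], Hy as [Hy Hyu].
    unfold hom in Hhom; rewrite allb_spec in Hhom; specialize (Hhom x Hxu).
    rewrite allb_spec in Hhom; specialize (Hhom y Hyu). rewrite Hx, Hy in Hhom.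
    apply eqb_prop in Hhom. rewrite !pattern_st in Hhom by lia.
    rewrite (R_anti e x z), (resv_R (S u) e x z), (resv_R (S u) e y z), Hhom by (auto; lia).
    destruct (W (pr y (1 + 2 * e))), (R e x y); reflexivity. }
  assert (Hnnn : forall x y z, new x -> new y -> new z -> cyc e x y z = false).
  { intros x y z [Hx Hx'] [Hy Hy'] [Hz Hz'].
    unfold acyc in Hacyc; rewrite allb_spec in Hacyc; specialize (Hacyc x Hx').
    rewrite allb_spec in Hacyc; specialize (Hacyc y Hy').
    rewrite allb_spec in Hacyc; specialize (Hacyc z Hz').
    rewrite Hx, Hy, Hz in Hacyc; now apply negb_true_iff in Hacyc. }
  assert (Hres : resv M (s_ (S u)) c = true -> resv M (s_ t0) c = true)
    by (apply resv_le; lia).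
  assert (Hc' : old c \/ new c \/ resv M (s_ (S u)) c = true).
  { destruct Hc as [[Hc Hc']|Hc]; [|auto]. destruct (Hsplit c Hc Hc'); auto. }
  (* Rotating a cycle brings the elements chosen before the question to the front, where [Hold] and
     [Hside] apply. *)
  destruct (Hsplit a Ha Ha') as [oa|na], (Hsplit b Hb Hb') as [ob|nb],
    Hc' as [oc|[nc|rc]]; auto.
  - rewrite <- cyc_rot; auto.
  - rewrite cyc_rot; auto.
  - rewrite cyc_rot; auto.
  - rewrite cyc_rot; auto.
  - rewrite <- cyc_rot; auto.
Qed.

(** * The generic of a run with infinite reservoirs and correct answers *)

Hypothesis infinite_resv : forall t n, exists y, n < y /\ resv M (s_ t) y = true.
Hypothesis right_answer : forall t, sm (s_ t) = 0 ->
  W (pr t 0) = true <-> exists l, solvable M (s_ t) l = false.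

(** Each time at which the search fails shows the guessed pattern to be a good colouring at that
    level. Failing forever would make all levels solvable, against the positive answer. *)
Lemma search_ends t : sm (s_ t) = 0 -> W (pr t 0) = true ->
  exists u E, t < u /\ Ext M (s_ t) u (pattern (sL (s_ u)) u) E = true /\
     sm (s_ (S u)) = 0 /\ sq (s_ (S u)) = S (sq (s_ t)) /\
     forall y, bit (sF (s_ (S u))) y = (y <? u) && (bit (sF (s_ t)) y || bit E y).
Proof.
  intros Hm Hw. destruct (st_yes t Hm Hw) as [HF [Hq HS]].
  set (goal := exists u E, _).
  assert (Hk : forall k, goal \/ (sF (s_ (k + S t)) = sF (s_ t) /\
    sq (s_ (k + S t)) = sq (s_ t) /\ sm (s_ (k + S t)) = S (s_ t) /\
    (0 < k -> solvable M (s_ t) (k + t) = true))).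
  { induction k as [|k [IH|[IF [Iq [Im _]]]]]; [right; repeat split; auto; lia|auto|].
    destruct (st_search (k + S t)) as [[E [_ [HX [H1 [H2 HE]]]]]|[HG [H1 [H2 H3]]]];
      [congruence| |].
    - left; exists (k + S t), E. rewrite Im in HX. rewrite IF in HE.
      repeat split; [lia|exact HX|exact H1|congruence|exact HE].
    - right. change (S k + S t) with (S (k + S t)).
      refine (conj _ (conj _ (conj _ (fun _ => _)))); try congruence.
      rewrite Im in HG; apply solvable_spec.
      replace (S k + t) with (k + S t) by lia; eauto. }
  apply right_answer in Hw as [l Hl]; [|exact Hm].
  destruct (Hk (S l)) as [H|[_ [_ [_ H]]]]; [exact H|].
  exfalso. specialize (H ltac:(lia)). apply solvable_spec in H as [c Hc].
  assert (solvable M (s_ t) l = true); [|congruence].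
  apply solvable_spec; exists c; apply (Good_mono M _ l (S l + t)); [lia|exact Hc].
Qed.

Lemma question_asked n : exists t, n <= t /\ sm (s_ t) = 0 /\ sq (s_ t) = n.
Proof.
  induction n as [|n [t [Ht [Hm Hq]]]].
  - exists 0; split; [lia|split; [apply sm_mk|apply sq_mk]].
  - destruct (W (pr t 0)) eqn:Hw.
    + destruct (search_ends t Hm Hw) as [u [E [Hu [_ [H1 [H2 _]]]]]].
      exists (S u); split; [lia|split; [exact H1|congruence]].
    + destruct (st_no t Hm Hw) as [_ [H1 [H2 _]]].
      exists (S t); split; [lia|split; [exact H2|congruence]].
Qed.

Definition generic : set := fun y =>
  if excluded_middle_informative (exists t, bit (sF (s_ t)) y = true) then true else false.

Lemma generic_spec y : generic y = true <-> exists t, bit (sF (s_ t)) y = true.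
Proof.
  unfold generic; destruct (excluded_middle_informative _); split; auto; discriminate.
Qed.

Lemma generic_from t y : sm (s_ t) = 0 -> generic y = true ->
  bit (sF (s_ t)) y = true \/ resv M (s_ t) y = true.
Proof.
  intros Hm Hy; apply generic_spec in Hy as [t' Ht'].
  apply (new_in_resv t (max t t')); [exact Hm|lia|]. apply (sF_le t'); [lia|exact Ht'].
Qed.

Lemma generic_below t y : sm (s_ t) = 0 -> y < t -> generic y = bit (sF (s_ t)) y.
Proof.
  intros Hm Hy. destruct (generic y) eqn:E.
  - destruct (generic_from t y Hm E) as [H|H]; [auto|]. apply resv_ge in H; lia.
  - destruct (bit (sF (s_ t)) y) eqn:E2; [|reflexivity].
    rewrite <- E; apply generic_spec; eauto.
Qed.

Lemma generic_acyclic_from e t : sm (s_ t) = 0 -> e < t -> forall a b c,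
  generic a = true -> bit (sF (s_ t)) a = false ->
  generic b = true -> bit (sF (s_ t)) b = false ->
  generic c = true -> bit (sF (s_ t)) c = false -> cyc e a b c = false.
Proof.
  intros Hm He a b c Ha Ha' Hb Hb' Hc Hc'.
  apply generic_spec in Ha as [ta Ha], Hb as [tb Hb], Hc as [tc Hc].
  set (t' := t + ta + tb + tc).
  apply (new_acyclic e t t'); auto; try lia.
  - apply (sF_le ta); [lia|exact Ha].
  - apply (sF_le tb); [lia|exact Hb].
  - left; split; [|exact Hc']. apply (sF_le tc); [lia|exact Hc].
Qed.

Lemma generic_acyclic e : exists m, forall a b c, m <= a -> m <= b -> m <= c ->
  generic a = true -> generic b = true -> generic c = true -> cyc e a b c = false.
Proof.
  destruct (question_asked (S e)) as [t [Ht [Hm _]]]. exists t; intros a b c Ha Hb Hc ? ? ?.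
  assert (Hout : forall x, t <= x -> bit (sF (s_ t)) x = false).
  { intros x Hx; destruct (bit (sF (s_ t)) x) eqn:E; [|reflexivity].
    apply sF_lt in E; lia. }
  apply (generic_acyclic_from e t); auto.
Qed.

(** After a correct negative answer all levels are solvable, so column [s_ t] of [M] is good at each
    of them. The constraint added at time [t] confines the next reservoir to one colour of this
    column; sets drawn from it are homogeneous, and goodness forbids them to force halting. *)
Lemma no_extension t l E : sm (s_ t) = 0 -> W (pr t 0) = false -> E < 2 ^ l ->
  (forall y, bit E y = true -> resv M (s_ (S t)) y = true) ->
  (forall e, e < t -> acyc e l E = true) ->
  halt_in (fun y => bit (sF (s_ t)) y || bit E y) l (sq (s_ t)) = false.
Proof.
  intros Hm Hw HE Hres Hac.
  assert (HG : Good M (s_ t) l (fun i => M (pr (s_ t) i)) = true).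
  { generalize (M_solves (s_ t) l); unfold solves.
    destruct (solvable M (s_ t) l) eqn:E1; [auto|].
    assert (W (pr t 0) = true); [|congruence]. apply right_answer; eauto. }
  destruct (halt_in _ l (sq (s_ t))) eqn:EH; [|reflexivity]. exfalso.
  unfold Good in HG; rewrite allb_spec in HG; specialize (HG E HE).
  apply negb_true_iff in HG. rewrite <- not_true_iff_false in HG; apply HG.
  unfold Ext; rewrite !andb_true_iff, !allb_spec, sT_st. repeat split; [| |exact EH].
  - intros y _; destruct (bit E y) eqn:Ey; [|reflexivity].
    apply (resv_le t (S t)); auto.
  - intros e He; rewrite andb_true_iff; split; [|auto].
    destruct (st_no t Hm Hw) as [_ [_ [_ [v Hv]]]].
    assert (Hcol : forall y, bit E y = true -> M (pr (s_ t) (pr e y)) = bit v e).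
    { intros y Hy. apply Hres in Hy. rewrite st_S, resv_advance, <- st_S in Hy.
      destruct Hy as [_ [_ Hy]]. unfold chk in Hy.
      rewrite Hv, andb_true_iff in Hy. destruct Hy as [_ Hy].
      cbn [Nat.eqb orb Nat.pred] in Hy. rewrite allb_spec, sT_st in Hy.
      specialize (Hy e He). now rewrite p1_pr, p2_pr, eqb_true_iff in Hy. }
    unfold hom; rewrite allb_spec; intros x _; rewrite allb_spec; intros y _.
    destruct (bit E x) eqn:Ex, (bit E y) eqn:Ey; try reflexivity.
    simpl; rewrite !Hcol by auto. apply eqb_reflx.
Qed.

(** Positive answer: the set found by the search makes the computation halt with queries below [u],
    where the generic no longer changes. Negative answer: a halting computation sees finitely many
    elements of the generic; those outside the finite part form an acyclic set in the next
    reservoir, which [no_extension] rules out. *)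
Lemma jump_generic t : sm (s_ t) = 0 -> jump generic (sq (s_ t)) = W (pr t 0).
Proof.
  intros Hm. destruct (W (pr t 0)) eqn:Hw.
  - destruct (search_ends t Hm Hw) as [u [E [Hu [HX [H1 [H2 HE]]]]]].
    unfold Ext in HX; rewrite andb_true_iff in HX; destruct HX as [_ HX].
    apply jump_spec; exists u.
    apply (halt_in_mono (fun y => bit (sF (s_ t)) y || bit E y) _ u u); [|lia|exact HX].
    intros i Hi. rewrite (generic_below (S u)) by (auto; lia). rewrite HE.
    now apply Nat.ltb_lt in Hi as ->.
  - destruct (jump generic (sq (s_ t))) eqn:EJ; [|reflexivity].
    apply jump_spec in EJ as [l Hl]. destruct (st_no t Hm Hw) as [HF [_ [Hm' _]]].
    set (A := fun y => generic y && negb (bit (sF (s_ t)) y)).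
    assert (HA : forall y, bit (cnum A l) y = true ->
      y < l /\ generic y = true /\ bit (sF (s_ t)) y = false).
    { intros y Hy; rewrite bit_cnum in Hy; unfold A in Hy.
      rewrite !andb_true_iff, negb_true_iff, Nat.ltb_lt in Hy; tauto. }
    rewrite <- (no_extension t l (cnum A l) Hm Hw (cnum_lt _ _)).
    + symmetry; apply (halt_in_mono generic _ l l); [|lia|exact Hl].
      intros i Hi; rewrite bit_cnum; apply Nat.ltb_lt in Hi as ->; unfold A; simpl.
      destruct (bit (sF (s_ t)) i) eqn:Ei; [apply generic_spec; eauto|].
      now rewrite andb_true_r.
    + intros y Hy; apply HA in Hy as [_ [Hy Hy']].
      destruct (generic_from (S t) y Hm' Hy) as [H|H]; [|exact H].
      rewrite HF in H; congruence.
    + intros e He. unfold acyc; rewrite allb_spec; intros x _; rewrite allb_spec; intros y _;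
        rewrite allb_spec; intros z _.
      destruct (bit (cnum A l) x) eqn:Ex, (bit (cnum A l) y) eqn:Ey,
        (bit (cnum A l) z) eqn:Ez; try reflexivity; simpl.
      apply HA in Ex as [_ [? ?]], Ey as [_ [? ?]], Ez as [_ [? ?]].
      rewrite (generic_acyclic_from e t); auto.
Qed.

(* If the generic were bounded, the question asking for a further element would be answered
   negatively, although adding one element of the reservoir makes the answer positive. *)
Lemma generic_infinite n : exists m, n <= m /\ generic m = true.
Proof.
  apply NNPP; intros Hno.
  destruct (Sigma1_jump (fun X : set => X) (fun X x y => (x <=? y) && X y)) as [q [_ Hq]].
  { apply compb_and; [comps|].
    apply (compb_oracle (fun X : set => X) (fun _ z => p2 z)); comps. }
  destruct (question_asked (q n)) as [t [_ [Hm Ht]]].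
  assert (Hw : W (pr t 0) = false).
  { rewrite <- jump_generic by exact Hm. rewrite Ht.
    destruct (jump generic (q n)) eqn:E; [|reflexivity].
    apply Hq in E as [y Hy]. rewrite andb_true_iff, Nat.leb_le in Hy.
    exfalso; apply Hno; exists y; exact Hy. }
  destruct (infinite_resv (S t) n) as [y [Hny Hy]].
  set (A := fun i => bit (sF (s_ t)) i || (i =? y)).
  assert (HA : jump A (q n) = true).
  { apply Hq; exists y. unfold A. rewrite Nat.eqb_refl, orb_true_r, andb_true_r.
    apply Nat.leb_le; lia. }
  apply jump_spec in HA as [l0 Hl0].
  set (l := max l0 (S y)). set (E := cnum (fun i => i =? y) l).
  assert (HE : forall i, bit E i = true <-> i = y).
  { intros i; unfold E. rewrite bit_cnum, andb_true_iff, Nat.ltb_lt, Nat.eqb_eq; lia. }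
  assert (HN : halt_in (fun i => bit (sF (s_ t)) i || bit E i) l (sq (s_ t)) = false).
  { apply no_extension; [exact Hm|exact Hw|apply cnum_lt| |].
    - intros i Hi; apply HE in Hi as ->; exact Hy.
    - intros e _. unfold acyc; rewrite allb_spec; intros a _; rewrite allb_spec; intros b _;
        rewrite allb_spec; intros c _.
      destruct (bit E a) eqn:Ea, (bit E b) eqn:Eb, (bit E c) eqn:Ec; try reflexivity.
      apply HE in Ea as ->, Eb as ->. unfold cyc; now rewrite R_irr. }
  rewrite <- Ht in Hl0. apply (halt_in_mono A (fun i => bit (sF (s_ t)) i || bit E i) l0 l) in Hl0;
    [congruence| |lia].
  intros i Hi; unfold A; f_equal. unfold E; rewrite bit_cnum.
  assert (i <? l = true) as -> by (apply Nat.ltb_lt; lia). reflexivity.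
Qed.

End Run.

(** * Existence of correct guesses and the jump of the generic *)

Lemma pigeonhole (f : nat -> nat -> bool) (X : nat -> Prop) n :
  (forall m, exists y, m < y /\ X y) ->
  exists b : set, forall m, exists y, m < y /\ X y /\ forall e, e < n -> f e y = b e.
Proof.
  intros HX; induction n as [|n [b Hb]].
  - exists (fun _ => false); intros m; destruct (HX m) as [y [H1 H2]].
    exists y; repeat split; auto; lia.
  - assert (H : exists c, forall m, exists y, m < y /\ X y /\
      (forall e, e < n -> f e y = b e) /\ f n y = c).
    { apply NNPP; intros Hno.
      assert (Hc : forall c, exists m, forall y, m < y -> X y ->
        (forall e, e < n -> f e y = b e) -> f n y <> c).
      { intros c; apply NNPP; intros H; apply Hno; exists c; intros m.
        apply NNPP; intros H'; apply H; exists m; intros y ? ? ? ?; apply H'; eauto. }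
      destruct (Hc true) as [m1 H1], (Hc false) as [m2 H2].
      destruct (Hb (max m1 m2)) as [y [Hy [HXy Hby]]].
      destruct (f n y) eqn:E; [apply (H1 y)|apply (H2 y)]; auto; lia. }
    destruct H as [c Hc]. exists (fun e => if e =? n then c else b e); intros m.
    destruct (Hc m) as [y [H1 [H2 [H3 H4]]]]. exists y; repeat split; auto.
    intros e He; destruct (Nat.eqb_spec e n) as [->|]; [exact H4|apply H3; lia].
Qed.

Definition good_row (M : set) (s : nat) (r : nat -> bool) : Prop :=
  (forall n, exists y, n < y /\ resv M (advance M r s) y = true) /\
  (r 0 = true <-> exists l, solvable M s l = false).

Lemma good_row_exists M s : (forall n, exists y, n < y /\ resv M s y = true) ->
  exists r, good_row M s r.
Proof.
  intros HX.
  (* Two successive thinnings keep the reservoir infinite: first the directions from [sT s], then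
     the colour under column [s], are made constant. *)
  destruct (pigeonhole (fun e y => R e (sT s) y) _ (sT s) HX) as [b Hb].
  assert (Hb' : forall m, exists y, m < y /\
    (resv M s y = true /\ forall e, e < sT s -> R e (sT s) y = b e)) by exact Hb.
  destruct (pigeonhole (fun e y => M (pr s (pr e y))) _ (sT s) Hb') as [c Hc].
  set (ans := if excluded_middle_informative (exists l, solvable M s l = false)
              then true else false).
  set (r i := if i =? 0 then ans
              else if Nat.even (pred i) then b (Nat.div2 (pred i)) else c (Nat.div2 (pred i))).
  assert (Hr1 : forall e, r (1 + 2 * e) = b e).
  { intros e; unfold r. change (1 + 2 * e =? 0) with false; cbv iota.
    change (pred (1 + 2 * e)) with (2 * e).
    rewrite Nat.even_mul, Nat.div2_double; reflexivity. }
  assert (Hr2 : forall e, r (2 + 2 * e) = c e).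
  { intros e; unfold r. change (2 + 2 * e =? 0) with false; cbv iota.
    change (pred (2 + 2 * e)) with (S (2 * e)).
    rewrite Nat.even_succ, Nat.odd_mul, Nat.div2_succ_double; reflexivity. }
  exists r; split.
  - intros n. destruct (Hc (max n (sT s))) as [y [Hy [[HXy Hby] Hcy]]].
    exists y; split; [lia|]. apply resv_advance; repeat split; [exact HXy|lia|].
    assert (Hu : forall e, e < sT s -> R e (sT s) y = bit (cnum (fun e => r (1 + 2 * e)) (sT s)) e).
    { intros e He; rewrite bit_cnum, Hr1; assert (e <? sT s = true) as -> by now apply Nat.ltb_lt.
      apply Hby, He. }
    assert (Hv : forall e, e < sT s ->
      M (pr s (pr e y)) = bit (cnum (fun e => r (2 + 2 * e)) (sT s)) e).
    { intros e He; rewrite bit_cnum, Hr2; assert (e <? sT s = true) as -> by now apply Nat.ltb_lt.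
      apply Hcy, He. }
    unfold chk, advance; cbv zeta.
    destruct (sm s =? 0); [destruct (r 0)|destruct (exb _ _)]; proj;
      rewrite ?p1_pr, ?p2_pr, ?p1_pr, ?p2_pr, andb_true_iff, allb_spec;
      (split; [intros e He; rewrite Hu by exact He; apply eqb_reflx|]);
      try reflexivity.
    cbn [Nat.eqb Nat.pred orb]. rewrite p1_pr, p2_pr, allb_spec.
    intros e He; rewrite Hv by exact He; apply eqb_reflx.
  - change (r 0) with ans. unfold ans.
    destruct (excluded_middle_informative _); split; auto; discriminate.
Qed.

Definition valid_run (M W : set) : Prop :=
  (forall t n, exists y, n < y /\ resv M (st M W t) y = true) /\
  (forall t, sm (st M W t) = 0 ->
     W (pr t 0) = true <-> exists l, solvable M (st M W t) l = false).

(** Time [t] of a run reads only row [t] of [W], and whether a row is good depends only on the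
    current state, so the rows can be chosen along the sequence of states. *)
Lemma valid_run_exists M : exists W, valid_run M W.
Proof.
  set (pick s := epsilon (inhabits (fun _ : nat => false)) (good_row M s)).
  set (state := nat_rect (fun _ => nat) (mk 0 0 0 0 0) (fun _ s => advance M (pick s) s)).
  set (W := fun n => pick (state (p1 n)) (p2 n)).
  assert (Hst : forall t, st M W t = state t).
  { induction t as [|t IH]; [reflexivity|]. rewrite st_S, IH; simpl; fold state.
    assert (Hrow : forall i, W (pr t i) = pick (state t) i)
      by (intros; unfold W; now rewrite p1_pr, p2_pr).
    assert (Hcn : forall f g : set, (forall i, f i = g i) -> forall n, cnum f n = cnum g n).
    { intros f g Hfg n; induction n as [|n IHn]; simpl; [reflexivity|].
      fold (cnum f n) (cnum g n); congruence. }
    unfold advance; cbv zeta. rewrite Hrow.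
    rewrite (Hcn (fun e => W (pr t (1 + 2 * e))) (fun e => pick (state t) (1 + 2 * e)))
      by (intros; apply Hrow).
    rewrite (Hcn (fun e => W (pr t (2 + 2 * e))) (fun e => pick (state t) (2 + 2 * e)))
      by (intros; apply Hrow).
    reflexivity. }
  assert (Hgood : forall t, (forall n, exists y, n < y /\ resv M (state t) y = true) /\
    good_row M (state t) (pick (state t))).
  { assert (Hp : forall s, (forall n, exists y, n < y /\ resv M s y = true) ->
      good_row M s (pick s)).
    { intros s Hs. apply (epsilon_spec (inhabits (fun _ : nat => false)) (good_row M s)).
      now apply good_row_exists. }
    induction t as [|t [_ IH]].
    - assert (H0 : forall n, exists y, n < y /\ resv M (state 0) y = true).
      { intros n; exists (S n); split; [lia|]. unfold resv. simpl. now rewrite sT_mk. }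
      split; auto.
    - assert (HS : forall n, exists y, n < y /\ resv M (state (S t)) y = true) by apply IH.
      split; auto. }
  exists W; split.
  - intros t; rewrite Hst; apply Hgood.
  - intros t _. rewrite Hst. unfold W; rewrite p1_pr, p2_pr. apply Hgood.
Qed.

Theorem generic_exists P : PA_rel P (jump emptyset) ->
  exists G : set, (forall n, exists m, n <= m /\ G m = true) /\
    (forall e, exists m, forall x y z, m <= x -> m <= y -> m <= z ->
       G x = true -> G y = true -> G z = true -> cyc e x y z = false) /\
    Treducible (jump G) P.
Proof.
  intros HP.
  destruct (low_member (fun M z => solves M (p1 z) (p2 z))) as [M [HM HMlow]].
  { apply (compb_solves (fun X : set => X) (fun X => X));
      [apply (compb_oracle (fun X : set => X) (fun _ z => z))| |]; comps. }
  { destruct solving_family_exists as [M HM]; exists M; auto. }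
  assert (M_solves : forall s l, solves M s l = true)
    by (intros s l; generalize (HM (pr s l)); now rewrite p1_pr, p2_pr).
  clear HM.
  assert (oid : compb (fun X : set => X) (fun X z => X z))
    by (apply (compb_oracle (fun X : set => X) (fun _ z => z)); comps).
  (* Both facts are Sigma^0_1 in [M]. Thus [inf] and [ans] turn them into membership questions about
     [jump M], which lowness makes computable from the halting problem. *)
  destruct (Sigma1_jump (fun X : set => X) (fun X x y => (p2 x <? y) && resv X (p1 x) y))
    as [inf [Hinf_comp Hinf]].
  { apply compb_and; [comps|]. apply (compb_resv (fun X : set => X) (fun X => X)); comps. }
  destruct (Sigma1_jump (fun X : set => X) (fun X s l => negb (solvable X s l)))
    as [ans [Hans_comp Hans]].
  { apply compb_neg, (compb_solvable (fun X : set => X) (fun X => X)); comps. }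
  specialize (Hinf M). specialize (Hans M). cbv beta in Hinf, Hans.
  assert (Hjump : compb (join (jump emptyset)) (fun _ z => jump M z)).
  { apply (comp_oracle_trans _ (fun _ => jump emptyset)); [|apply compb_join_l].
    destruct HMlow as [p Hp]; exists p; intros _; exact Hp. }
  assert (HMc : compb (join (jump emptyset)) (fun _ z => M z)).
  { apply (comp_oracle_trans _ (fun _ => jump M)); [|exact Hjump].
    destruct (jump_above M) as [p Hp]; exists p; intros _; exact Hp. }
  (* Infinity of the reservoir at time [p1 z] is split into one instance for each bound [p2 z];
     every instance is decidable from the halting problem and [W]. *)
  destruct (PA_rel_member P (jump emptyset) (fun W z =>
    jump M (inf (pr (st M W (p1 z)) (p2 z))) &&
    (negb (sm (st M W (p1 z)) =? 0) ||
     eqb (W (pr (p1 z) 0)) (jump M (ans (st M W (p1 z))))))) as [W [HW HWP]].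
  - exact HP.
  - pose proof (compb_join_r (jump emptyset)) as HWc.
    assert (Hst : comp (join (jump emptyset)) (fun W z => st M W (p1 z)))
      by (apply (comp_st (join (jump emptyset)) (fun _ => M) HMc (fun W => W)); comps).
    apply compb_and.
    + apply (compb_app _ (fun _ => jump M) (fun W z => inf (pr (st M W (p1 z)) (p2 z))));
        [exact Hjump|]. apply Hinf_comp, comp_pr; [exact Hst|comps].
    + apply compb_or; [unfold sm; comps; exact Hst|].
      apply compb_beq; [apply (compb_app _ (fun W z => W z)); [exact HWc|comps]|].
      apply (compb_app _ (fun _ => jump M) (fun W z => ans (st M W (p1 z)))); [exact Hjump|].
      apply Hans_comp; exact Hst.
  - destruct (valid_run_exists M) as [W [H1 H2]]. exists W; intros z.
    rewrite andb_true_iff, orb_true_iff, negb_true_iff, Nat.eqb_neq, eqb_true_iff; split.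
    + apply Hinf. rewrite p1_pr, p2_pr. destruct (H1 (p1 z) (p2 z)) as [y [Hy Hy']].
      exists y; now rewrite Hy', andb_true_r, Nat.ltb_lt.
    + destruct (Nat.eq_dec (sm (st M W (p1 z))) 0) as [H0|H0]; [right|left; exact H0].
      apply eq_true_iff_eq. rewrite H2, Hans by exact H0.
      split; intros [l Hl]; exists l; [now rewrite Hl|now apply negb_true_iff].
  - assert (H1 : forall t n, exists y, n < y /\ resv M (st M W t) y = true).
    { intros t n. generalize (HW (pr t n)). rewrite p1_pr, p2_pr, andb_true_iff.
      intros [H _]. apply Hinf in H as [y Hy]. rewrite p1_pr, p2_pr, andb_true_iff, Nat.ltb_lt in Hy.
      exists y; exact Hy. }
    assert (H2 : forall t, sm (st M W t) = 0 ->
      W (pr t 0) = true <-> exists l, solvable M (st M W t) l = false).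
    { intros t H0. generalize (HW (pr t 0)).
      rewrite p1_pr, p2_pr, andb_true_iff, orb_true_iff, negb_true_iff, Nat.eqb_neq, eqb_true_iff.
      intros [_ [H|H]]; [contradiction|]. rewrite H, Hans.
      split; intros [l Hl]; exists l; [now apply negb_true_iff|now rewrite Hl]. }
    exists (generic M W). split; [|split].
    + intros n. exact (generic_infinite M W M_solves H1 H2 n).
    + intros e. exact (generic_acyclic M W H2 e).
    + assert (HMP : compb (fun _ : unit => P) (fun _ => M)).
      { apply Treducible_comp. apply (Treducible_trans _ (jump M)); [apply jump_above|].
        apply (Treducible_trans _ (jump emptyset)); [exact HMlow|now apply PA_rel_reduces]. }
      apply Treducible_comp in HWP.
      assert (Hst : comp2 (fun _ : unit => P) (fun _ n t => st M W t))
        by (apply (comp_st (fun _ : unit => P) (fun _ => M) HMP (fun _ => W)); comps).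
      apply Treducible_comp.
      (* [P] computes [M] and [W], hence the run, and can wait for the first time at which question
         [n] is asked; the answer recorded there is bit [n] of the jump. *)
      set (F n t := (sm (st M W t) =? 0) && (sq (st M W t) =? n)).
      assert (HF : forall n, exists t, F n t = true /\ forall j, j < t -> F n j = false).
      { intros n. destruct (question_asked M W H2 n) as [t [_ [Hm Hq]]].
        destruct (least_true (F n) t) as [t' [_ Ht']]; [|eauto].
        unfold F; now rewrite Hm, Hq, !Nat.eqb_refl. }
      set (r n := epsilon (inhabits 0) (fun t => F n t = true /\ forall j, j < t -> F n j = false)).
      assert (Hr : forall n, F n (r n) = true /\ forall j, j < r n -> F n j = false)
        by (intros n; apply (epsilon_spec (inhabits 0)
              (fun t => F n t = true /\ forall j, j < t -> F n j = false)), HF).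
      apply (compb_ext _ (fun _ n => W (pr (r n) 0))).
      * apply (compb_app _ (fun _ => W) (fun _ n => pr (r n) 0)); [exact HWP|].
        apply comp_pr; [|comps].
        apply (comp_mu _ (fun _ n t => F n t) (fun _ n => r n)).
        -- unfold F, sm, sq; comps; exact Hst.
        -- intros _ n; apply Hr.
        -- intros _ n; apply Hr.
      * intros _ n. destruct (Hr n) as [Hn _]. unfold F in Hn.
        rewrite andb_true_iff, !Nat.eqb_eq in Hn. destruct Hn as [Hm Hq].
        rewrite <- (jump_generic M W M_solves H2 (r n) Hm), Hq. reflexivity.
Qed.

End Forcing.

(** * Uniformly computable tournaments *)

(* Stage [x] has verified that [z] lies in the domain with code [p1 e] and has computed the
   tournament with code [p2 e] on all pairs [<w, z>] with [w <= z]. *)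
Definition verified (e x z : nat) : bool :=
  (U emptyset x (p1 e) z =? 2) &&
  allb (S z) (fun w => negb (U emptyset x (p2 e) (pr w z) =? 0)).

(** The largest verified element below [x]. The default 0 need not lie in the domain, but for an
    infinite computable tournament it no longer occurs from some stage on. *)
Definition latest (e x : nat) : nat :=
  nat_rect (fun _ => nat) 0 (fun z acc => if verified e x z then z else acc) x.

(** [U] returns one more than the output, so 2 stands for true. Stages with the same [latest] are
    ordered by size to obtain a tournament. As [latest] is monotone, for [x < y] the queried pair
    has the form [<w, z>] with [w <= z], as covered by [verified]. *)
Definition upward (e x y : nat) : bool :=
  (latest e x =? latest e y) || (U emptyset y (p2 e) (pr (latest e x) (latest e y)) =? 2).

(* Pulling a partial computable tournament back along [latest] makes it total, uniformly in [e]. *)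
Definition tourn (e x y : nat) : bool :=
  if x <? y then upward e x y else if y <? x then negb (upward e y x) else false.

Lemma tourn_anti e x y : x <> y -> tourn e y x = negb (tourn e x y).
Proof.
  intros H; unfold tourn.
  destruct (Nat.ltb_spec x y), (Nat.ltb_spec y x); try lia; [reflexivity|].
  now rewrite negb_involutive.
Qed.

Lemma tourn_irr e x : tourn e x x = false.
Proof. unfold tourn; now rewrite Nat.ltb_irrefl. Qed.

Lemma comp_latest J (o : J -> set) f g : comp o f -> comp o g ->
  comp o (fun i x => latest (f i x) (g i x)).
Proof. intros; unfold latest, verified, emptyset; comps. Qed.

Lemma compb_upward J (o : J -> set) f g h : comp o f -> comp o g -> comp o h ->
  compb o (fun i x => upward (f i x) (g i x) (h i x)).
Proof.
  intros Hf Hg Hh. pose proof (comp_latest J o f g Hf Hg). pose proof (comp_latest J o f h Hf Hh).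
  unfold upward, emptyset; comps.
Qed.

Lemma compb_tourn J (o : J -> set) f g h : comp o f -> comp o g -> comp o h ->
  compb o (fun i x => tourn (f i x) (g i x) (h i x)).
Proof.
  intros Hf Hg Hh. pose proof (compb_upward J o f g h Hf Hg Hh).
  pose proof (compb_upward J o f h g Hf Hh Hg). unfold tourn; comps.
Qed.

Lemma latest_spec e x z : z < x -> verified e x z = true ->
  z <= latest e x /\ verified e x (latest e x) = true.
Proof.
  unfold latest; intros Hz Hv.
  assert (H : forall n, z < n ->
    let h := nat_rect (fun _ => nat) 0 (fun z acc => if verified e x z then z else acc) n in
    z <= h /\ verified e x h = true); [|auto].
  induction n as [|n IH]; intros Hn; simpl; [lia|].
  destruct (verified e x n) eqn:E; [split; [lia|exact E]|].
  apply IH. destruct (Nat.eq_dec z n) as [->|]; [congruence|lia].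
Qed.

Lemma latest_cases e x : latest e x = 0 \/ (latest e x < x /\ verified e x (latest e x) = true).
Proof.
  unfold latest.
  assert (H : forall n,
    let h := nat_rect (fun _ => nat) 0 (fun z acc => if verified e x z then z else acc) n in
    h = 0 \/ (h < n /\ verified e x h = true)); [|auto].
  induction n as [|n IH]; simpl; [auto|].
  destruct (verified e x n) eqn:E; [right; auto|]. destruct IH as [IH|[IH IH']]; auto.
Qed.

Lemma verified_mono e x x' z : x <= x' -> verified e x z = true -> verified e x' z = true.
Proof.
  unfold verified; rewrite !andb_true_iff, !Nat.eqb_eq, !allb_spec.
  intros Hx [H1 H2]; split.
  - apply (U_mono emptyset emptyset x x'); auto.
  - intros w Hw; specialize (H2 w Hw).
    destruct (U emptyset x (p2 e) (pr w z)) as [|v] eqn:E; [discriminate|].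
    now rewrite (U_mono emptyset emptyset x x' _ _ v) by auto.
Qed.

Lemma latest_mono e x x' : x <= x' -> latest e x <= latest e x'.
Proof.
  intros Hx. destruct (latest_cases e x) as [->|[H1 H2]]; [lia|].
  apply latest_spec; [lia|]. now apply (verified_mono e x).
Qed.

Lemma bounded_stage (Q : nat -> nat -> Prop) n :
  (forall w, w < n -> exists t, forall x, t <= x -> Q w x) ->
  exists t, forall x, t <= x -> forall w, w < n -> Q w x.
Proof.
  induction n as [|n IH]; intros H; [exists 0; intros; lia|].
  destruct IH as [t Ht]; [intros; apply H; lia|]. destruct (H n) as [t' Ht']; [lia|].
  exists (max t t'); intros x Hx w Hw. destruct (Nat.eq_dec w n) as [->|].
  - apply Ht'; lia.
  - apply Ht; lia.
Qed.

(** * From the generic to a solution of one computable tournament *)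

Section Instance.
Context (D : set) (T : nat -> nat -> bool) (pD pT : prog).
Hypothesis HT : tournament D T.
Hypothesis HpD : forall x, conv pD emptyset x (b2n (D x)).
Hypothesis HpT : forall x y, conv pT emptyset (pr x y) (b2n (T x y)).
Let e := pr (code pD) (code pT).

Lemma verified_domain x z : verified e x z = true -> D z = true.
Proof.
  unfold verified, e; rewrite p1_pr, andb_true_iff, Nat.eqb_eq. intros [H _].
  apply U_sound in H. pose proof (conv_det _ _ _ _ _ (HpD z) H).
  destruct (D z); [reflexivity|discriminate].
Qed.

Lemma verified_eventually z : D z = true -> exists t, forall x, t <= x -> verified e x z = true.
Proof.
  intros Hz. generalize (HpD z); rewrite Hz; intros H.
  apply U_complete in H as [t1 H1].
  destruct (bounded_stage (fun w x => negb (U emptyset x (p2 e) (pr w z) =? 0) = true) (S z))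
    as [t2 H2].
  { intros w _. destruct (U_complete _ _ _ _ (HpT w z)) as [t Ht]. exists t; intros x Hx.
    unfold e; rewrite p2_pr, (U_mono emptyset emptyset t x _ _ _ (fun _ _ => eq_refl) Hx Ht); reflexivity. }
  exists (max t1 t2); intros x Hx. unfold verified; rewrite andb_true_iff, allb_spec; split.
  - unfold e; rewrite p1_pr, (U_mono emptyset emptyset t1 x _ _ 1); auto; lia.
  - apply H2; lia.
Qed.

Lemma verified_value x y w z : x <= y -> verified e x z = true -> w <= z ->
  (U emptyset y (p2 e) (pr w z) =? 2) = T w z.
Proof.
  unfold verified; rewrite andb_true_iff, allb_spec. intros Hxy [_ H] Hw.
  specialize (H w ltac:(lia)). unfold e in *; rewrite p2_pr in *.
  destruct (U emptyset x (code pT) (pr w z)) as [|v] eqn:E; [discriminate|].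
  rewrite (U_mono emptyset emptyset x y _ _ v) by auto.
  rewrite <- (conv_det _ _ _ _ _ (HpT w z) (U_sound _ _ _ _ _ E)). now destruct (T w z).
Qed.

Lemma latest_unbounded z : exists t, forall x, t <= x ->
  z < latest e x /\ verified e x (latest e x) = true.
Proof.
  destruct HT as [Hinf _]. destruct (Hinf (S z)) as [z' [Hz' HD]].
  destruct (verified_eventually z' HD) as [t Ht]. exists (max t (S z')); intros x Hx.
  destruct (latest_spec e x z') as [H1 H2]; [lia|apply Ht; lia|]. split; [lia|exact H2].
Qed.

Lemma upward_value x y : x < y -> verified e y (latest e y) = true ->
  latest e x <> latest e y -> upward e x y = T (latest e x) (latest e y).
Proof.
  intros Hxy Hv Hne. unfold upward. destruct (Nat.eqb_spec (latest e x) (latest e y)); [contradiction|].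
  simpl. apply (verified_value y); auto. apply latest_mono; lia.
Qed.

Lemma tourn_value x y : verified e x (latest e x) = true -> verified e y (latest e y) = true ->
  latest e x <> latest e y -> tourn e x y = T (latest e x) (latest e y).
Proof.
  intros Hx Hy Hne. destruct HT as [_ [_ [_ Hor]]]. unfold tourn.
  destruct (Nat.ltb_spec x y); [now apply upward_value|].
  destruct (Nat.ltb_spec y x).
  - rewrite upward_value by auto.
    destruct (Hor (latest e x) (latest e y)) as [[-> ->]|[-> ->]];
      eauto using verified_domain.
  - replace y with x in Hne by lia; contradiction.
Qed.

(** [H] is the image under [latest] of a tail of [G]. A 3-cycle of [T] in it would lift to one of
    the pulled-back tournament, and a tournament without 3-cycles is transitive. *)
Lemma solution_computable (G : set) m :
  (forall n, exists x, n <= x /\ G x = true) ->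
  (forall x y z, m <= x -> m <= y -> m <= z ->
     G x = true -> G y = true -> G z = true -> cyc tourn e x y z = false) ->
  exists H, infinite_set H /\ transitive_sub D T H /\ Treducible H G.
Proof.
  (* From [t0] on the default of [latest] does not occur, so all its values are verified elements of
     [D]. *)
  intros Ginf Gac. destruct (latest_unbounded 0) as [t0 Ht0].
  set (far z x := z <? latest e x).
  assert (Hfar : forall z, exists b, far z b = true /\ forall j, j < b -> far z j = false).
  { intros z; destruct (latest_unbounded z) as [t Ht]. destruct (Ht t) as [Hz _]; [lia|].
    destruct (least_true (far z) t) as [b [_ Hb]]; [now apply Nat.ltb_lt|eauto]. }
  (* [b z] is the first stage at which [latest] exceeds [z]. By monotonicity only smaller stages can
     represent [z], so a bounded search decides [H] from [G]. *)
  set (b z := epsilon (inhabits 0) (fun b => far z b = true /\ forall j, j < b -> far z j = false)).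
  assert (Hb : forall z, far z (b z) = true /\ forall j, j < b z -> far z j = false)
    by (intros z; apply (epsilon_spec (inhabits 0)
          (fun b => far z b = true /\ forall j, j < b -> far z j = false)), Hfar).
  set (H z := exb (b z) (fun x => (max m t0 <=? x) && G x && (latest e x =? z))).
  assert (HH : forall z, H z = true <->
    exists x, m <= x /\ t0 <= x /\ G x = true /\ latest e x = z).
  { intros z; unfold H; rewrite exb_spec; split; intros [x Hx]; exists x;
      rewrite !andb_true_iff, Nat.leb_le, Nat.eqb_eq in *.
    - destruct Hx as [_ [[Hx HG] Hl]]; repeat split; auto; lia.
    - destruct Hx as [Hm [Ht [HG Hl]]]; repeat split; auto; [|lia].
      destruct (Nat.lt_ge_cases x (b z)) as [|Hbx]; [assumption|]. exfalso.
      destruct (Hb z) as [Hf _]; apply Nat.ltb_lt in Hf. pose proof (latest_mono e _ _ Hbx); lia. }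
  exists H; split; [|split; [split|]].
  - intros n. destruct (latest_unbounded n) as [t Ht].
    destruct (Ginf (m + t0 + t)) as [x [Hx HG]]. exists (latest e x); split.
    + destruct (Ht x); lia.
    + apply HH; exists x; repeat split; auto; lia.
  - intros z Hz; apply HH in Hz as [x [_ [Hx [_ <-]]]].
    apply (verified_domain x), Ht0, Hx.
  - intros z1 z2 z3 H1 H2 H3 H12 H23.
    destruct HT as [_ [_ [Hirr Hor]]].
    apply HH in H1 as [x1 [Hm1 [Ht1 [G1 E1]]]], H2 as [x2 [Hm2 [Ht2 [G2 E2]]]],
      H3 as [x3 [Hm3 [Ht3 [G3 E3]]]].
    destruct (Ht0 x1 Ht1) as [_ V1], (Ht0 x2 Ht2) as [_ V2], (Ht0 x3 Ht3) as [_ V3].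
    assert (D1 : D z1 = true) by (rewrite <- E1; eauto using verified_domain).
    assert (D2 : D z2 = true) by (rewrite <- E2; eauto using verified_domain).
    assert (D3 : D z3 = true) by (rewrite <- E3; eauto using verified_domain).
    assert (N12 : z1 <> z2) by (intros ->; rewrite Hirr in H12; discriminate).
    assert (N23 : z2 <> z3) by (intros ->; rewrite Hirr in H23; discriminate).
    assert (N13 : z1 <> z3).
    { intros ->. destruct (Hor z3 z2 D3 D2 N12) as [[_ ?]|[? _]]; congruence. }
    generalize (Gac x1 x2 x3 Hm1 Hm2 Hm3 G1 G2 G3). unfold cyc.
    rewrite !tourn_value by (auto; congruence). rewrite E1, E2, E3, H12, H23; simpl.
    intros H31. destruct (Hor z1 z3 D1 D3 N13) as [[? _]|[_ ?]]; congruence.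
  - apply Treducible_comp.
    assert (Hlat : comp (fun _ : unit => G) (fun _ x => latest e x))
      by (apply (comp_latest unit _ (fun _ _ => e) (fun _ x => x)); comps).
    assert (HG : compb (fun _ : unit => G) (fun _ x => G x))
      by (apply (compb_oracle (fun _ : unit => G) (fun _ x => x)); comps).
    assert (Hbc : comp (fun _ : unit => G) (fun _ z => b z)).
    { apply (comp_mu _ (fun _ z x => far z x) (fun _ z => b z)); [|intros _; apply Hb..].
      unfold far; comps. apply (comp_app _ (fun _ x => latest e x) (fun _ z => p2 z)); comps. }
    unfold H. apply (compb_exb _ (fun _ z => b z)); [exact Hbc|].
    comps.
    + apply (compb_app _ (fun _ x => G x) (fun _ z => p2 z)); comps.
    + apply (comp_app _ (fun _ x => latest e x) (fun _ z => p2 z)); comps.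
Qed.

End Instance.

Theorem theorem5 (P : set) :
  PA_rel P (jump emptyset) ->
  exists G : set, bounds_EM G /\ Treducible (jump G) P.
Proof.
  intros HP.
  destruct (generic_exists tourn tourn_anti tourn_irr compb_tourn P HP) as [G [Ginf [Gac GP]]].
  exists G; split; [|exact GP]. intros D T HT [[pD HD] [pT HpT]].
  destruct (Gac (pr (code pD) (code pT))) as [m Hm].
  apply (solution_computable D T pD pT HT HD) with (m := m); auto.
  intros x y. generalize (HpT (pr x y)). now rewrite p1_pr, p2_pr.
Qed.
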